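(* Let $\Omega\subset\mathbb{R}$ be a bounded open interval, $b\in\mathbb{R}\setminus\{0\}$ constant, $f\in L_2(\Omega)$, $\mathcal{T}_h$ a mesh of $\Omega$, and $u_h\in L_2(\Omega)$. (i) If the residual $\mathcal{R}(u_h)$ satisfies the $\psi_a$-orthogonality $$\langle\mathcal{R}(u_h),\psi_a\rangle=(f,\psi_a)_{\omega_a}+(u_h,b\nabla\psi_a)_{\omega_a}=0\qquad\forall\, a\in\mathcal{V}_h^{\mathrm{int}}\cup\mathcal{V}_h^{\partial_-\Omega},$$ then $$\|\mathcal{R}(u_h)\|^2_{b;\,H^1_+(\Omega)'}\le 2\,C_{\mathrm{cont,PF}}^2\sum_{a\in\mathcal{V}_h}\|\mathcal{R}(u_h)\|^2_{b;\,H^1_\#(\omega_a)'}.$$ (ii) Independently of the $\psi_a$-orthogonality, it always holds that $$\sum_{a\in\mathcal{V}_h}\|\mathcal{R}(u_h)\|^2_{b;\,H^1_\#(\omega_a)'}\le 2\,\|\mathcal{R}(u_h)\|^2_{b;\,H^1_+(\Omega)'}.$$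
   Context: Notation: $(v,w)_D=\int_D vw$, $\|v\|_D=(v,v)_D^{1/2}$, with the subscript dropped when $D=\Omega$; $\nabla v=v'$. For an open interval $D$ with outward unit normal $n=\pm1$ at its endpoints, $\partial_\pm D=\{x\in\partial D:\pm b\,n(x)>0\}$ ($-$ inflow, $+$ outflow) and $H^1_\pm(D)=\{w\in H^1(D): w=0\text{ on }\partial_\pm D\}$. Residual: for $u_h\in L_2(\Omega)$, $\langle\mathcal{R}(u_h),v\rangle=(f,v)+(u_h,b\nabla v)$ for $v\in H^1_+(\Omega)$, with $$\|\mathcal{R}(u_h)\|_{b;\,H^1_+(\Omega)'}=\sup_{v\in H^1_+(\Omega)\setminus\{0\}}\frac{\langle\mathcal{R}(u_h),v\rangle}{\|b\nabla v\|}.$$ Mesh: $\mathcal{T}_h$ is a finite division of $\Omega$ into non-overlapping intervals covering $\Omega$, shape regular in the sense that any two neighboring intervals have comparable lengths up to a constant $\kappa_{\mathcal{T}_h}$. $\mathcal{V}_h=\mathcal{V}_h^{\mathrm{int}}\cup\mathcal{V}_h^{\partial_-\Omega}\cup\mathcal{V}_h^{\partial_+\Omega}$ is the set of mesh vertices, split into interior, inflow ($\in\partial_-\Omega$) and outflow ($\in\partial_+\Omega$) vertices. For $a\in\mathcal{V}_h$, $\omega_a$ is the open subdomain (interval) formed by the mesh elements having $a$ as a vertex, $h_{\omega_a}$ is its diameter, and $\psi_a$ is the continuous piecewise affine hat function equal to $1$ at $a$ and $0$ at all other vertices (so $\operatorname{supp}\psi_a=\overline{\omega_a}$). Patch spaces: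 $H^1_\#(\omega_a)=H^1_0(\omega_a)$ if $a\notin\mathcal{V}_h^{\partial_-\Omega}$ and $H^1_\#(\omega_a)=H^1_+(\omega_a)$ if $a\in\mathcal{V}_h^{\partial_-\Omega}$. Functions in $H^1_\#(\omega_a)$ extended by zero belong to $H^1_+(\Omega)$, so one can define $$\|\mathcal{R}(u_h)\|_{b;\,H^1_\#(\omega_a)'}=\sup_{v\in H^1_\#(\omega_a)\setminus\{0\}}\frac{\langle\mathcal{R}(u_h),v\rangle}{\|b\nabla v\|_{\omega_a}}.$$ Also, $H^1_*(\omega_a)=\{v\in H^1(\omega_a):(v,1)_{\omega_a}=0\}$ if $a\notin\mathcal{V}_h^{\partial_+\Omega}$ and $H^1_*(\omega_a)=H^1_+(\omega_a)$ if $a\in\mathcal{V}_h^{\partial_+\Omega}$. Constant: $C_{\mathrm{PF},\omega_a}>0$ is a constant in the Poincaré(–Friedrichs) inequality $\|v\|_{\omega_a}\le h_{\omega_a}C_{\mathrm{PF},\omega_a}\|\nabla v\|_{\omega_a}$ for all $v\in H^1_*(\omega_a)$ (for an interval it can be taken equal to $1$), and $$C_{\mathrm{cont,PF}}=\max_{a\in\mathcal{V}_h}\bigl(1+C_{\mathrm{PF},\omega_a}h_{\omega_a}\|\nabla\psi_a\|_\infty\bigr).$$ *)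

(* Defs.v *)
From HB Require Import structures.
From mathcomp Require Export all_boot all_order all_algebra.
From mathcomp Require Export all_classical all_reals all_analysis.
Export Order.TTheory GRing.Theory Num.Def Num.Theory.
Export numFieldNormedType.Exports.

Set Implicit Arguments.
Unset Strict Implicit.
Unset Printing Implicit Defensive.

Local Open Scope classical_set_scope.
Local Open Scope ring_scope.

Section Sobolev.
Context {R : realType}.
Local Notation mu := (@lebesgue_measure R).
Implicit Types (D : set R) (v w g : R -> R).

(* Elements of L_2(D) and H^1(D) are represented by functions R -> R, of which
   only the values almost everywhere on D matter. *)
Definition L2 D : set (R -> R) := [set v | v \_ D \in Lfun mu 2%:E].

Definition L2inner D v w : R := \int[mu]_(x in D) (v x * w x).

Definition L2norm D v : R := Num.sqrt (L2inner D v v).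

Definition zero_ae D v : Prop := {ae mu, forall x, D x -> v x = 0}.

(* C^1_c(D), the test functions usual for Sobolev spaces in one dimension *)
Definition test_function D : set (R -> R) :=
  [set phi : R -> R | [/\ forall x, derivable phi x 1,
                 continuous (derive1 phi),
                 compact (closure [set x | phi x != 0]) &
                 closure [set x | phi x != 0] `<=` D]].

Definition is_weak_derivative D v g : Prop :=
  L2 D g /\
  forall phi, test_function D phi -> L2inner D v (derive1 phi) = - L2inner D g phi.

Definition H1 D : set (R -> R) :=
  [set v | L2 D v /\ exists g, is_weak_derivative D v g].

(* A weak derivative is unique only up to equality almost everywhere on D; the
   choice made here is immaterial. *)
Definition grad D v : R -> R := get [set g | is_weak_derivative D v g].

(* Boundary values are those of the representative of v that is continuous on
   the closure of the interval. *)
Definition vanishes_on (l r : R) (A : set R) v : Prop :=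
  exists w, [/\ {within `[l, r], continuous w},
                {ae mu, forall x, x \in `]l, r[ -> w x = v x} &
                forall x, A x -> w x = 0].

Definition boundary (l r : R) : set R := [set l; r].

Definition outward_normal (l r x : R) : R := if x == l then -1 else 1.

Definition inflow (b l r : R) : set R :=
  [set x | boundary l r x /\ 0 < - (b * outward_normal l r x)].

Definition outflow (b l r : R) : set R :=
  [set x | boundary l r x /\ 0 < b * outward_normal l r x].

Definition H1_0 (l r : R) : set (R -> R) :=
  [set v | H1 `]l, r[ v /\ vanishes_on l r (boundary l r) v].

Definition H1_plus (b l r : R) : set (R -> R) :=
  [set v | H1 `]l, r[ v /\ vanishes_on l r (outflow b l r) v].

Definition residual D (f u : R -> R) (b : R) v : R :=
  L2inner D f v + L2inner D u (b \*o grad D v).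

(* The norm of a functional T on V, V being normed by v |-> || b v' ||_D. *)
Definition dual_norm (b : R) D (V : set (R -> R)) (T : (R -> R) -> R) : \bar R :=
  ereal_sup [set (T v / L2norm D (b \*o grad D v))%:E |
             v in [set v | V v /\ ~ zero_ae D v]].

End Sobolev.

(* The elements of the mesh of ]l, r[ are the intervals between consecutive
   items of l :: s. *)
Section Mesh.
Context {R : realType}.
Local Notation mu := (@lebesgue_measure R).
Variables (b l r : R) (s : seq R).

(* vertex i = r for every i >= size s *)
Definition vertex (i : nat) : R := nth r (l :: s) i.

Definition mesh (kappa : R) : Prop :=
  itv_partition l r s /\
  forall i, (i.+1 < size s)%N ->
    let h j := vertex j.+1 - vertex j in
    h i <= kappa * h i.+1 /\ h i.+1 <= kappa * h i.

(* For the two extreme vertices the patch has a single element: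
   0.-1 = 0 and vertex (size s).+1 = r. *)
Definition omega_l (i : nat) : R := vertex i.-1.
Definition omega_r (i : nat) : R := vertex i.+1.
Definition omega (i : nat) : set R := `]omega_l i, omega_r i[.
Definition omega_diam (i : nat) : R := omega_r i - omega_l i.

Definition hat (i : nat) (x : R) : R :=
  if x == vertex i then 1
  else if vertex i.-1 < x < vertex i then
    (x - vertex i.-1) / (vertex i - vertex i.-1)
  else if vertex i < x < vertex i.+1 then
    (vertex i.+1 - x) / (vertex i.+1 - vertex i)
  else 0.

Definition interior_vertex (i : nat) : Prop := vertex i \in `]l, r[.
Definition inflow_vertex (i : nat) : Prop := vertex i \in inflow b l r.

Definition H1_sharp (i : nat) : set (R -> R) :=
  [set v | if vertex i \in inflow b l r
           then H1_plus b (omega_l i) (omega_r i) v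
           else H1_0 (omega_l i) (omega_r i) v].

Definition H1_star (i : nat) : set (R -> R) :=
  [set v | if vertex i \in outflow b l r
           then H1_plus b (omega_l i) (omega_r i) v
           else H1 (omega i) v /\ L2inner (omega i) v (cst 1) = 0].

Definition poincare_constant (i : nat) (C : R) : Prop :=
  0 < C /\
  forall v, H1_star i v ->
    L2norm (omega i) v <= omega_diam i * C * L2norm (omega i) (grad (omega i) v).

Definition grad_hat_Linfty (i : nat) : \bar R :=
  'N[mu]_+oo [EFin \o (grad `]l, r[ (hat i) \_ `]l, r[)].

Definition C_cont_PF (C_PF : 'I_(size s).+1 -> R) : \bar R :=
  \big[maxe/-oo%E]_(i < (size s).+1)
    (1 + (C_PF i)%:E * (omega_diam i)%:E * grad_hat_Linfty i)%E.

Definition global_residual_norm (f u : R -> R) : \bar R :=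
  dual_norm b `]l, r[ (H1_plus b l r) (residual `]l, r[ f u b).

(* v \_ (omega i) is the extension of v by zero *)
Definition local_residual_norm (f u : R -> R) (i : nat) : \bar R :=
  dual_norm b (omega i) (H1_sharp i)
    (fun v => residual `]l, r[ f u b (v \_ (omega i))).

End Mesh.

(* Main.v *)
Require Import Defs.
From mathcomp Require Import ring lra measurable_realfun.

Set Implicit Arguments.
Unset Strict Implicit.
Unset Printing Implicit Defensive.

Local Open Scope classical_set_scope.
Local Open Scope ring_scope.

(** Why the theorem holds.

    In one dimension every function of H^1(]c, d[) agrees almost everywhere
    with k + \int_c^x g, where g is its weak derivative
    ([H1_has_primitive]), and its boundary values are the values of that
    continuous function ([vanishes_on_primitive]).  Let F be the primitive
    of f that vanishes on the inflow boundary, and q := b u - F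
    ([flux]).  Integrating (f, v) by parts, the boundary terms vanish at the
    inflow because F does and at the outflow because v does, so that the
    residual is represented by q:
      <R(u), v> = (q, v') for all v in H^1_+(]l, r[)
    ([residual_primitive]).

    By Cauchy-Schwarz, every dual norm in the statement is thus at most
    ||q|| / |b|, the norm being taken on the subinterval that carries the
    test functions ([patch_norm_upper]), with equality as soon as q is itself
    the derivative of an admissible test function ([patch_normE]).  On
    ]l, r[ this is always so, as no condition binds the mean of v' there:
    the global norm is ||q|| / |b| ([global_residual_normE]).

    Part (ii): the sum of the squared local norms is at most the sum of
    ||q||^2 / b^2 over the patches, and each mesh element belongs to exactly
    two patches ([sum_L2_omega]).

    Part (i): orthogonality to the hat function of a vertex says that q has
    the same mean on the elements left and right of it; at the inflow vertex,
    that q has mean 0 on the adjacent element.  Hence q has mean 0 on all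
    elements ([orthogonality_mean0]), so on each patch q is the derivative of
    a function vanishing at both ends, and each local norm equals
    ||q|| / |b| on its patch ([local_normE]).  The sum of their squares is
    then exactly twice the squared global norm, and the stated bound follows
    from C_cont_PF >= 1.

    The representation of H^1 functions rests on the lemma of du
    Bois-Reymond ([du_bois_reymond]) and on the integration by parts of
    primitives ([prim_parts]), itself a case of Fubini's theorem.  Functions
    on an interval are extended by zero to the line, so that all primitives
    start at -oo and a function supported in a patch has the same primitive
    whether it is seen on the patch or on ]l, r[. *)

(** * Primitives of integrable functions *)

(** For instance resolution, which does not see through the display of the
    Borel sets. *)
#[global] Instance ae_lebesgue_filter (R : realType) :
  Filter (almost_everywhere (@lebesgue_measure R)) :=
  ae_filter_ringOfSetsType (@lebesgue_measure R).

Section Primitive.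
Context {R : realType}.
Local Notation mu := (@lebesgue_measure R).
Local Notation integ g := (mu.-integrable setT (EFin \o g)).
Implicit Types (f g h v w : R -> R) (a b c d k l r x y : R) (D E : set R).

Lemma ae_eq_Rintegral (D : set R) f g : measurable D ->
  measurable_fun D f -> measurable_fun D g ->
  {ae mu, forall x, D x -> f x = g x} ->
  \int[mu]_(x in D) f x = \int[mu]_(x in D) g x.
Proof.
move=> mD mf mg fg; rewrite /Rintegral; congr fine.
apply: ae_eq_integral => //; [exact/measurable_EFinP|exact/measurable_EFinP|].
by apply: filterS fg => x fgx Dx; rewrite fgx.
Qed.

Lemma integ_measurable g : integ g -> measurable_fun setT g.
Proof. by move=> ig; apply/measurable_EFinP; exact: measurable_int ig. Qed.

Lemma integZ D k f : measurable D -> mu.-integrable D (EFin \o f) ->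
  mu.-integrable D (EFin \o (fun x => k * f x)).
Proof. by move=> mD ifD; exact: (@integrableZl _ _ _ mu D mD k (EFin \o f) ifD). Qed.

Lemma integB D f g : measurable D -> mu.-integrable D (EFin \o f) ->
  mu.-integrable D (EFin \o g) -> mu.-integrable D (EFin \o (fun x => f x - g x)).
Proof.
move=> mD ifD igD.
exact: (@integrableB _ _ _ mu D mD (EFin \o f) (EFin \o g) ifD igD).
Qed.

Lemma integ_patch (D : set R) g : measurable D ->
  integ (g \_ D) <-> mu.-integrable D (EFin \o g).
Proof.
move=> mD; have := integrable_mkcond (mu := mu) (EFin \o g) mD.
by rewrite restrict_EFin => ->.
Qed.

Lemma integ_patchS (D : set R) g : measurable D -> integ g -> integ (g \_ D).
Proof. by move=> mD ig; apply/integ_patch => //; exact: integrableS ig. Qed.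

Lemma patchM D v w : (fun x => v x * w x) \_ D = (fun x => (v \_ D) x * (w \_ D) x).
Proof. by apply/funext => x; rewrite !patchE; case: ifP => // _; rewrite mulr0. Qed.

Lemma patch_patchS (D E : set R) v : D `<=` E -> (v \_ D) \_ E = v \_ D.
Proof.
move=> DE; apply/funext => x; rewrite !patchE; case: ifPn => // xE.
by case: ifPn => // /set_mem/DE/mem_set; rewrite (negPf xE).
Qed.

Lemma patch_subset (D E : set R) v : D `<=` E -> (v \_ E) \_ D = v \_ D.
Proof.
move=> DE; apply/funext => x; rewrite !patchE; case: ifPn => // xD.
by rewrite mem_set//; apply: DE; exact: set_mem.
Qed.

Lemma integ_cst_patch (k : R) c d : integ ((cst k) \_ `]c, d[).
Proof.
apply/integ_patch => //.
apply: (@integrableS _ _ _ mu `[c, d]) => //; first exact: subset_itv_oo_cc.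
apply: continuous_compact_integrable; first exact: segment_compact.
by apply: continuous_subspaceT => x; exact: cvg_cst.
Qed.

Lemma integral_cst_itv (k : R) a b : a <= b -> \int[mu]_(x in `]a, b[) k = k * (b - a).
Proof.
move=> ab; rewrite Rintegral_cst//; congr (_ * _).
suff: fine (mu `]a, b[%classic) = b - a by [].
rewrite lebesgue_measure_itv/=; case: ifPn => [_|].
  by rewrite -EFinB.
by rewrite lte_fin -leNgt => ba; rewrite (le_anti (introT andP (conj ab ba))) subrr.
Qed.

Lemma integral_patchS f c d x y : c <= x -> y <= d ->
  \int[mu]_(t in `]x, y[) (f \_ `]c, d[) t = \int[mu]_(t in `]x, y[) f t.
Proof.
move=> cx yd; apply: eq_Rintegral => t; rewrite inE patchE mem_setE /= !in_itv/=.
by move=> /andP[xt ty]; rewrite (le_lt_trans cx xt) (lt_le_trans ty yd).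
Qed.

Definition prim g x : R := \int[mu]_(t in `]-oo, x]) g t.

Lemma primB g x y : integ g -> x <= y ->
  prim g y - prim g x = \int[mu]_(t in `]x, y]) g t.
Proof.
move=> ig xy; rewrite /prim -(@Rintegral_itvB _ g -oo%O (BRight y) x) //.
exact: integrableS ig.
Qed.

Lemma dist_prim g x y : integ g -> x <= y ->
  `|prim g y - prim g x| <= \int[mu]_(t in `]x, y]) `|g t|.
Proof.
move=> ig xy; rewrite primB//; apply: le_normr_Rintegral => //.
exact: integrableS ig.
Qed.

(** Absolute continuity of the integral: the increments of the primitive are
    integrals over short intervals. *)
Lemma prim_continuous g : integ g -> continuous (prim g).
Proof.
move=> ig x0; apply/cvgrPdist_lt => e e0.
have [d [d0 small]] := integral_normr_continuous ig e0.
have near_prim x y : x <= y -> `|x - y| < d -> `|prim g x - prim g y| < e.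
  move=> xy dxy; rewrite distrC; apply: le_lt_trans (dist_prim ig xy) _.
  apply: small => //.
  suff: (mu `]x, y]%classic < d%:E)%E by [].
  rewrite lebesgue_measure_itv/=; case: ifP => // _.
  by rewrite -EFinB lte_fin (le_lt_trans _ dxy)// distrC ler_norm.
near=> y.
have dxy : `|x0 - y| < d by near: y; exact: cvgr_dist_lt.
have [|/ltW] := leP x0 y => xy; first exact: near_prim.
by rewrite distrC near_prim// distrC.
Unshelve. all: by end_near. Qed.

Lemma measurable_prim g : integ g -> measurable_fun setT (prim g).
Proof. by move=> ig; apply: continuous_measurable_fun; exact: prim_continuous. Qed.

Lemma prim_bounded g x : integ g -> `|prim g x| <= \int[mu]_t `|g t|.
Proof.
move=> ig; apply: le_trans (le_normr_Rintegral _ _) _ => //.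
  exact: integrableS ig.
rewrite /Rintegral; apply: fine_le.
- apply: integrable_fin_num => //.
  by apply: integrable_norm; exact: integrableS ig.
- by apply: integrable_fin_num => //; exact: integrable_norm.
- apply: ge0_subset_integral => //; apply/measurable_EFinP.
  by apply: measurableT_comp => //; exact: integ_measurable.
Qed.

Lemma integ_mul_prim f g : integ f -> integ g -> integ (f \* prim g).
Proof.
move=> If Ig; have := integrableMl _ If (measurable_prim Ig).
apply => //.
exists (\int[mu]_t `|g t|); split; first exact: num_real.
move=> M gM x _ /=.
by apply: le_trans (prim_bounded _ Ig) (ltW gM).
Qed.

(** Lebesgue differentiation: almost everywhere g is the derivative of its
    primitive. *)
Lemma prim_constant_ae g c d : integ g ->
  (forall x y, x \in `]c, d[ -> y \in `]c, d[ -> prim g x = prim g y) ->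
  {ae mu, forall x, x \in `]c, d[ -> g x = 0}.
Proof.
move=> ig gcst.
have := @FTC1Ny R g; have ig' y : mu.-integrable `]-oo, y] (EFin \o g).
  exact: integrableS ig.
move=> /(_ ig' (open_integrable_locally openT ig)).
apply: filterS => x [_ <-] xcd.
rewrite derive1E -[RHS](derive_cst (prim g x : R^o) x (1 : R^o)).
apply: near_eq_derive.
have : \forall y \near x, y \in `]c, d[ by exact: near_in_itvoo.
by apply: filterS => y ycd; exact: gcst.
Qed.

(** Integration by parts on the whole line: by Fubini, the left-hand side is
    the integral of f(x) g(t) over t <= x, which is the integral over the
    plane minus the one over x < t. *)
Lemma prim_parts f g : integ f -> integ g ->
  \int[mu]_x (f x * prim g x) =
  (\int[mu]_x f x) * (\int[mu]_x g x) - \int[mu]_x (g x * prim f x).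
Proof.
move=> If Ig.
have mf := integ_measurable If; have mg := integ_measurable Ig.
(* the integrand restricted to the half-plane t <= x *)
pose h (z : R * R) : \bar R := (f z.1 * g z.2 * (z.2 <= z.1)%R%:R)%:E.
have mh : measurable_fun setT h.
  apply/measurable_EFinP; apply: measurable_funM.
    by apply: measurable_funM; exact: measurableT_comp.
  rewrite [X in measurable_fun _ X](_ : _ =
    fun z : R * R => if z.2 <= z.1 then 1 else 0); last first.
    by apply/funext => z; case: ifP.
  apply: measurable_fun_ifT => //; exact: measurable_fun_ler.
pose k (z : R * R) : \bar R := (f z.1 * g z.2)%:E.
have mk : measurable_fun setT k.
  by apply/measurable_EFinP; apply: measurable_funM; exact: measurableT_comp.
have ik : (mu \x mu)%E.-integrable setT k.
  apply/integrable12ltyP => //; rewrite /k /=.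
  have -> : (\int[mu]_x \int[mu]_y `|f x * g y|%:E =
      \int[mu]_x (`|f x|%:E * \int[mu]_y `|g y|%:E))%E.
    apply: eq_integral => x _; under eq_integral do rewrite normrM EFinM.
    rewrite ge0_integralZl//; apply/measurable_EFinP.
    by apply: measurableT_comp.
  rewrite ge0_integralZr//; last 2 first.
  - by apply/measurable_EFinP; exact: measurableT_comp.
  - by apply: integral_ge0 => *; rewrite lee_fin.
  apply: lte_mul_pinfty; first exact: integral_ge0.
    by apply: integrable_fin_num => //; exact: integrable_norm.
  by have /integrableP[] := Ig.
have ih : (mu \x mu)%E.-integrable setT h.
  apply: le_integrable ik => // -[x y] _ /=.
  rewrite lee_fin normrM ler_piMr// normr_nat lern1; exact: leq_b1.
have := Fubini ih.
have -> : (\int[mu]_x \int[mu]_y h (x, y) = \int[mu]_x (f x * prim g x)%:E)%E.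
  apply: eq_integral => x _; rewrite /h/=.
  rewrite (_ : (fun y => _) =
      fun y => (f x)%:E * ((g \_ `]-oo, x]) y)%:E)%E; last first.
    apply/funext => y; rewrite -EFinM patchE mem_setE in_itv/= -mulrA.
    by case: ifP => _; rewrite ?mulr1 ?mulr0.
  rewrite integralZl//; last exact: integ_patchS.
  rewrite EFinM /prim Rintegral_mkcond /Rintegral fineK//.
  by apply: integrable_fin_num => //; exact: integ_patchS.
have -> : (\int[mu]_y \int[mu]_x h (x, y) =
  \int[mu]_y (g y * (\int[mu]_x f x - prim f y))%:E)%E.
  apply: eq_integral => y _; rewrite /h/=.
  rewrite (_ : (fun x => _) =
      fun x => (g y)%:E * ((f \_ `[y, +oo[) x)%:E)%E; last first.
    apply/funext => x; rewrite -EFinM patchE mem_setE in_itv/= andbT mulrAC mulrC.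
    by case: ifP => _; rewrite ?mulr1 ?mulr0.
  rewrite integralZl//; last exact: integ_patchS.
  rewrite EFinM -set_itvNyy Rintegral_itvB ?set_itvNyy//.
  rewrite Rintegral_itv_obnd_cbnd; last exact: integrableS If.
  rewrite Rintegral_mkcond /Rintegral fineK//.
  by apply: integrable_fin_num => //; exact: integ_patchS.
move=> /(congr1 fine); rewrite -[LHS]/(Rintegral _ _ _) -[RHS]/(Rintegral _ _ _) => ->.
under eq_Rintegral do rewrite mulrBr.
rewrite RintegralB//; last 2 first.
- exact: integrableZr (Ig).
- exact: integ_mul_prim.
- by rewrite RintegralZr// mulrC.
Qed.

Lemma prim_patch g c d x : prim (g \_ `]c, d[) x =
  \int[mu]_(t in `]-oo, x] `&` `]c, d[) g t.
Proof. by rewrite /prim -Rintegral_mkcondr. Qed.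

Lemma prim_patch_left g c d x : x <= c -> prim (g \_ `]c, d[) x = 0.
Proof.
move=> xc; rewrite prim_patch (_ : _ `&` _ = set0) ?Rintegral_set0//.
by apply/seteqP; split=> t //=; rewrite !in_itv/= => -[tx /andP[]]; lra.
Qed.

Lemma prim_patch_right g c d x : d <= x ->
  prim (g \_ `]c, d[) x = \int[mu]_(t in `]c, d[) g t.
Proof.
move=> dx; rewrite prim_patch; congr Rintegral; apply/seteqP.
split=> [t [] //|t cdt]; split=> //.
by move: cdt; rewrite /= !in_itv/= => /andP[_ /ltW/le_trans->].
Qed.

Lemma prim_patch_inside g c d x : x < d ->
  prim (g \_ `]c, d[) x = \int[mu]_(t in `]c, x]) g t.
Proof.
move=> xd; rewrite prim_patch; congr Rintegral; apply/seteqP.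
split=> t /=; rewrite !in_itv/=; first by move=> [-> /andP[->]].
by move=> /andP[-> tx]; rewrite tx (le_lt_trans tx).
Qed.

Lemma integral_primB l r h x y : l <= x -> x <= y -> y <= r ->
  integ (h \_ `]l, r[) ->
  \int[mu]_(t in `]x, y[) h t = prim (h \_ `]l, r[) y - prim (h \_ `]l, r[) x.
Proof.
move=> lx xy yr ih; rewrite primB// -Rintegral_itv_bndo_bndc; last first.
  exact: integrableS ih.
by rewrite integral_patchS.
Qed.

Lemma prim_cst1 a d x : a <= d ->
  prim ((cst (1 : R)) \_ `]a, d[) x =
  if x <= a then 0 else if x < d then x - a else d - a.
Proof.
move=> ad; have [xa|ax] := leP x a; first by rewrite prim_patch_left.
have [xd|dx] := ltP x d; last by rewrite prim_patch_right// integral_cst_itv// mul1r.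
rewrite prim_patch_inside// -Rintegral_itv_bndo_bndc; last first.
  apply: (@integrableS _ _ _ mu `[a, x]) => //; first exact: subset_itv_oo_cc.
  apply: continuous_compact_integrable; first exact: segment_compact.
  by apply: continuous_subspaceT => z; exact: cvg_cst.
by rewrite integral_cst_itv ?mul1r// ltW.
Qed.

End Primitive.

(** * Test functions and the lemma of du Bois-Reymond *)

Section DuBoisReymond.
Context {R : realType}.
Local Notation mu := (@lebesgue_measure R).
Local Notation integ g := (mu.-integrable setT (EFin \o g)).
Implicit Types (v w phi psi : R -> R) (a b c d x y : R) (D : set R).

Lemma test_function_off D phi x : @test_function R D phi -> ~ D x -> phi x = 0.
Proof.
case=> _ _ _ sD nDx; apply: contra_notP nDx => /eqP phix.
by apply: sD; exact: subset_closure.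
Qed.

Lemma test_function_integrable D phi c d : @test_function R D phi ->
  mu.-integrable `[c, d] (EFin \o (derive1 phi)).
Proof.
case=> _ cphi _ _; apply: continuous_compact_integrable.
  exact: segment_compact.
exact: continuous_subspaceT.
Qed.

Lemma test_function_FTC D phi x y : @test_function R D phi -> x <= y ->
  \int[mu]_(t in `]x, y]) (derive1 phi) t = phi y - phi x.
Proof.
move=> tphi; rewrite le_eqVlt => /predU1P[->|xy].
  by rewrite set_itvoc0 Rintegral_set0 subrr.
have [dphi cphi _ _] := tphi.
rewrite Rintegral_itv_obnd_cbnd; last first.
  by apply: integrableS (test_function_integrable x y tphi) => //; exact: subset_itv_oc_cc.
rewrite /Rintegral (@continuous_FTC2 _ _ phi)//.
- exact: continuous_subspaceT.
- have cphi0 z : {for z, continuous phi}.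
    by apply: differentiable_continuous; exact/derivable1_diffP.
  by split=> [z _| |]; [exact: dphi|apply: cvg_at_right_filter; exact: cphi0|
    apply: cvg_at_left_filter; exact: cphi0].
Qed.

Lemma prim_test_function phi c d x : test_function `]c, d[ phi ->
  x \in `]c, d[ -> prim ((derive1 phi) \_ `]c, d[) x = phi x.
Proof.
move=> tphi; rewrite in_itv/= => /andP[cx xd].
rewrite prim_patch_inside// (test_function_FTC tphi (ltW cx)).
by rewrite (test_function_off (x := c) tphi) ?subr0//= bound_in_itv.
Qed.

Lemma integral_test_function phi c d : c < d -> test_function `]c, d[ phi ->
  \int[mu]_(t in `]c, d[) (derive1 phi) t = 0.
Proof.
move=> cd tphi; rewrite Rintegral_itv_bndo_bndc; last first.
  by apply: integrableS (test_function_integrable c d tphi) => //; exact: subset_itv_oo_cc.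
rewrite (test_function_FTC tphi (ltW cd)).
by rewrite !(test_function_off tphi) ?subrr//= in_itv/= ltxx ?andbF.
Qed.

(** This is how test functions with a prescribed derivative are made: having
    total integral 0, [psi] has a primitive that vanishes to the right of the
    support of [psi], as it does to the left. *)
Lemma prim_is_test_function psi a b c d : c < a -> a <= b -> b < d ->
  continuous psi -> (forall x, x \notin `[a, b] -> psi x = 0) ->
  \int[mu]_x psi x = 0 ->
  test_function `]c, d[ (prim psi) /\ derive1 (prim psi) = psi.
Proof.
move=> ca ab bd cpsi psi0 int0.
have psiE : psi = psi \_ `[a, b].
  by apply/funext => x; rewrite patchE mem_setE; case: ifPn => // /psi0.
have ipsi : integ psi.
  rewrite psiE; apply/integ_patch => //; apply: continuous_compact_integrable.
    exact: segment_compact.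
  exact: continuous_subspaceT.
have derE x : derivable (prim psi) x 1 /\ derive1 (prim psi) x = psi x.
  have xx1 : x < x + 1 by rewrite ltrDl.
  apply: (continuous_FTC1 xx1) => //; [exact: integrableS ipsi|exact: ltNyr|exact: cpsi].
have der : derive1 (prim psi) = psi by apply/funext => x; case: (derE x).
have prim0 x : x \notin `[a, b] -> prim psi x = 0.
  rewrite in_itv/= negb_and -!ltNge => /orP[xa|bx].
    rewrite /prim -(Rintegral_set0 mu psi) Rintegral_mkcond [RHS]Rintegral_mkcond.
    apply: eq_Rintegral => t _; rewrite !patchE in_set0 mem_setE in_itv/=.
    by case: ifP => // tx; rewrite psi0// in_itv/= negb_and -!ltNge (le_lt_trans tx xa).
  rewrite -int0 /prim Rintegral_mkcond.
  apply: eq_Rintegral => t _; rewrite !patchE mem_setE in_itv/=.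
  case: leP => // tx; rewrite psi0// in_itv/= negb_and -!ltNge (lt_trans bx tx).
  by rewrite orbT.
have supp : closure [set x | prim psi x != 0] `<=` `[a, b].
  rewrite [X in _ `<=` X](closure_id _).1; last exact: itv_closed.
  apply: closure_subset => x /=; apply: contraR => xab.
  by apply/eqP/prim0.
split=> //; split.
- by move=> x; case: (derE x).
- by rewrite der.
- apply: subclosed_compact supp; first exact: closed_closure.
  exact: segment_compact.
- apply: subset_trans supp _ => x /=; rewrite !in_itv/= => /andP[ax xb].
  by rewrite (lt_le_trans ca)//= (le_lt_trans xb).
Qed.

(** A continuous function supported in [a, b] that increases to the indicator
    function of ]a, b[ as n grows: its ramps have slope n. *)
Definition trapezoid a b (n : nat) x : R :=
  minr 1 (n%:R * maxr 0 (minr (x - a) (b - x))).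

Lemma trapezoid_continuous a b n : continuous (trapezoid a b n).
Proof.
have c1 : continuous (fun x => minr (x - a) (b - x)).
  move=> x; apply: (@continuous_min R _ (fun x => x - a) (fun x => b - x)).
    by apply: cvgB => //; exact: cvg_cst.
  by apply: cvgB => //; exact: cvg_cst.
have c2 : continuous (fun x => n%:R * maxr 0 (minr (x - a) (b - x)) : R).
  move=> x; apply: cvgM; first exact: cvg_cst.
  apply: (@continuous_max R _ (cst 0) (fun x => minr (x - a) (b - x))).
    exact: cvg_cst.
  exact: c1.
move=> x; apply: (@continuous_min R _ (cst 1)
  (fun x => n%:R * maxr 0 (minr (x - a) (b - x)))); first exact: cvg_cst.
exact: c2.
Qed.

Lemma trapezoid_ge0 a b n x : 0 <= trapezoid a b n x.
Proof. by rewrite le_min ler01 mulr_ge0// le_max lexx. Qed.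

Lemma trapezoid_le1 a b n x : trapezoid a b n x <= 1.
Proof. by rewrite ge_min lexx. Qed.

Lemma trapezoid_off a b n x : x \notin `]a, b[ -> trapezoid a b n x = 0.
Proof.
rewrite in_itv/= negb_and -!leNgt => abx.
have m0 : minr (x - a) (b - x) <= 0 by rewrite ge_min !subr_le0.
by rewrite /trapezoid (max_idPl m0) mulr0 min_r.
Qed.

Lemma trapezoid_cvg a b x :
  trapezoid a b n x @[n --> \oo] --> (\1_`]a, b[ x : R).
Proof.
have [xab|xab] := boolP (x \in `]a, b[); last first.
  rewrite indicE memNset ?(negP xab)//; last exact/negP.
  by under eq_fun do rewrite trapezoid_off//; exact: cvg_cst.
rewrite indicE mem_set//.
have h0 : 0 < minr (x - a) (b - x).
  by move: xab; rewrite in_itv/= => /andP[? ?]; rewrite lt_min !subr_gt0; apply/andP.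
apply: cvg_near_cst.
near=> n; rewrite /trapezoid (max_idPr (ltW h0)) min_l//.
rewrite -ler_pdivrMr//; near: n; exact: nbhs_infty_ger.
Unshelve. all: by end_near. Qed.

Lemma integ_mul_trapezoid w a b n : integ w -> integ (w \* trapezoid a b n).
Proof.
move=> iw; apply: (integrableMl _ iw) => //.
  by apply: continuous_measurable_fun; exact: trapezoid_continuous.
exists 1; split=> // M M1 x _ /=; rewrite ger0_norm ?trapezoid_ge0//.
exact: le_trans (trapezoid_le1 _ _ _ _) (ltW M1).
Qed.

Lemma trapezoid_integral_cvg w a b : integ w ->
  \int[mu]_x (w x * trapezoid a b n x) @[n --> \oo] -->
  \int[mu]_(x in `]a, b[) w x.
Proof.
move=> iw; rewrite Rintegral_mkcond.
have mw := integ_measurable iw.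
apply: (@fine_cvg _ _ _ _ (fun n => \int[mu]_x (w x * trapezoid a b n x)%:E)%E).
rewrite fineK; last by apply: integrable_fin_num => //; exact: integ_patchS.
have [] := @dominated_convergence _ _ _ mu setT measurableT
  (fun n x => (w x * trapezoid a b n x)%:E) (EFin \o (w \_ `]a, b[))
  (EFin \o (normr \o w)).
- by move=> n; exact: measurable_int (integ_mul_trapezoid a b n iw).
- by apply: measurable_int; exact: (integ_patchS _ iw).
- apply: aeW => x _; apply: cvg_EFin; first exact: nearW.
  have -> : (w \_ `]a, b[) x = w x * \1_`]a, b[ x.
    by rewrite patchE indicE; case: ifP => _; rewrite ?mulr1 ?mulr0.
  by apply: cvgMl_tmp; exact: trapezoid_cvg.
- exact: integrable_norm.
- apply: aeW => x n _ /=.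
  by rewrite lee_fin normrM (ger0_norm (trapezoid_ge0 _ _ _ _)) ler_piMr// trapezoid_le1.
- by move=> _ _.
Qed.

(** For two intervals I and J, a combination of their trapezoids with total
    integral 0 is the derivative of a test function, hence orthogonal to v.
    In the limit of steep trapezoids, v has the same mean on I and on J.  So
    the primitive of v is affine, and v is its constant slope. *)
Lemma du_bois_reymond v c d : c < d -> mu.-integrable `]c, d[ (EFin \o v) ->
  (forall phi, test_function `]c, d[ phi ->
    \int[mu]_(x in `]c, d[) (v x * derive1 phi x) = 0) ->
  exists k, {ae mu, forall x, x \in `]c, d[ -> v x = k}.
Proof.
move=> cd iv vtest.
(* a reference interval, away from c and d *)
have [a [b [ca ab bd]]] : exists a b, [/\ c < a, a < b & b < d].
  by exists ((2 * c + d) / 3), ((c + 2 * d) / 3); split; lra.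
set V := v \_ `]c, d[; pose U : R -> R := (cst (1 : R)) \_ `]c, d[.
have iV : integ V by apply/integ_patch.
have iU : integ U by exact: integ_cst_patch.
have UI x y : c <= x -> x <= y -> y <= d -> \int[mu]_(t in `]x, y[) U t = y - x.
  by move=> cx xy yd; rewrite integral_patchS// integral_cst_itv// mul1r.
have trapU x y n : c < x -> y < d ->
    U \* trapezoid x y n = trapezoid x y n.
  move=> cx yd; apply/funext => t /=; rewrite /U patchE mem_setE.
  case: ifPn => tcd; rewrite ?mul1r// mul0r trapezoid_off//.
  apply: contra tcd; rewrite !in_itv/= => /andP[xt ty].
  by rewrite (lt_trans cx xt) (lt_trans ty yd).
pose I w x y n := \int[mu]_t (w t * trapezoid x y n t).
have cross n x y : c < x -> x <= y -> y < d ->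
    I U a b n * I V x y n = I U x y n * I V a b n.
  move=> cx xy yd.
  (* the weights make the integral of psi vanish *)
  pose psi t := I U a b n * trapezoid x y n t - I U x y n * trapezoid a b n t.
  have it x' y' : c < x' -> y' < d -> integ (trapezoid x' y' n).
    by move=> cx' yd'; rewrite -trapU//; exact: integ_mul_trapezoid.
  have IUE x' y' : c < x' -> y' < d -> I U x' y' n = \int[mu]_t trapezoid x' y' n t.
    by move=> cx' yd'; rewrite /I; congr Rintegral; exact: trapU.
  have cpsi : continuous psi.
    move=> t; apply: cvgB; apply: cvgM; try exact: cvg_cst; exact: trapezoid_continuous.
  have [||||||tpsi dpsi] := @prim_is_test_function psi (minr a x) (maxr b y) c d.
  - by rewrite lt_min ca.
  - by rewrite ge_min !le_max (ltW ab).
  - by rewrite gt_max bd.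
  - exact: cpsi.
  - move=> t tab; rewrite /psi !trapezoid_off ?mulr0 ?subrr//.
      apply: contra tab; rewrite !in_itv/= ge_min le_max => /andP[/ltW -> /ltW ->].
      by rewrite !(orbT, orTb).
    apply: contra tab; rewrite !in_itv/= ge_min le_max => /andP[/ltW -> /ltW ->].
    by rewrite !(orbT, orTb).
  - rewrite /psi RintegralB//; last 2 first.
    + by apply: integZ => //; exact: (it x y cx yd).
    + by apply: integZ => //; exact: (it a b ca bd).
    rewrite !RintegralZl//; [|exact: it|exact: it].
    by rewrite -!IUE// mulrC subrr.
  have := vtest _ tpsi; rewrite dpsi Rintegral_mkcond.
  have -> : ((fun t => v t * psi t) \_ `]c, d[) =
    fun t => I U a b n * (V t * trapezoid x y n t) - I U x y n * (V t * trapezoid a b n t).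
    apply/funext => t; rewrite /V !patchE; case: ifP => _; last by rewrite !mul0r !mulr0 subrr.
    by rewrite /psi; ring.
  rewrite RintegralB//; last 2 first.
  + by apply: integZ => //; exact: (integ_mul_trapezoid x y n iV).
  + by apply: integZ => //; exact: (integ_mul_trapezoid a b n iV).
  rewrite !RintegralZl//; [|exact: integ_mul_trapezoid|exact: integ_mul_trapezoid].
  by move/eqP; rewrite subr_eq0 => /eqP.
have avg x y : c < x -> x <= y -> y < d ->
    (b - a) * \int[mu]_(t in `]x, y[) V t = (y - x) * \int[mu]_(t in `]a, b[) V t.
  move=> cx xy yd; rewrite -!UI//; [|exact: ltW..].
  have cvgI w x' y' : integ w -> I w x' y' n @[n --> \oo] --> \int[mu]_(t in `]x', y'[) w t.
    exact: trapezoid_integral_cvg.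
  apply: (@cvg_unique _ (@Rhausdorff R) ((fun n => I U a b n * I V x y n) @ \oo)).
    by apply: cvgM; exact: cvgI.
  have -> : (fun n => I U a b n * I V x y n) = (fun n => I U x y n * I V a b n).
    by apply/funext => n; exact: cross.
  by apply: cvgM; exact: cvgI.
pose k := (\int[mu]_(t in `]a, b[) V t) / (b - a).
exists k.
pose w t := V t - k * U t.
have iw : integ w.
  by apply: integB => //; exact: integZ.
have w0 x y : c < x -> x <= y -> y < d -> prim w x = prim w y.
  move=> cx xy yd; apply/esym/eqP; rewrite -subr_eq0 primB//.
  rewrite -Rintegral_itv_bndo_bndc; last exact: integrableS iw.
  rewrite RintegralB//; last 2 first.
  - exact: integrableS iV.
  - by apply: integZ => //; exact: integrableS iU.
  rewrite RintegralZl//; last exact: integrableS iU.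
  rewrite UI//; [|exact: ltW..].
  rewrite subr_eq0 /k mulrAC -(mulrC (y - x)) -avg// mulrAC divff ?mul1r//.
  by rewrite subr_eq0 gt_eqF.
have wcst x y : x \in `]c, d[ -> y \in `]c, d[ -> prim w x = prim w y.
  rewrite !in_itv/= => /andP[cx xd] /andP[cy yd].
  by have [xy|/ltW xy] := leP x y; [exact: w0|apply/esym; exact: w0].
apply: filterS (prim_constant_ae iw wcst) => x /[swap] xcd /(_ xcd) /eqP.
by rewrite /w /V /U !patchE mem_setE xcd mulr1 subr_eq0 => /eqP.
Qed.

End DuBoisReymond.

(** * Square integrable functions *)

Section SquareIntegrable.
Context {R : realType}.
Local Notation mu := (@lebesgue_measure R).
Local Notation integ g := (mu.-integrable setT (EFin \o g)).
Implicit Types (f g v w : R -> R) (a b c d l r k x : R) (D E : set R).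

Lemma L2P D v : L2 D v <->
  measurable_fun setT (v \_ D) /\ integ (fun x => (v \_ D) x ^+ 2).
Proof.
rewrite /L2/=; split=> [L2v|[mv iv]].
  split; last exact: Lfun2_integrable_sqr.
  by have /andP[] := L2v; rewrite inE.
rewrite inE; apply/andP; split; rewrite inE//= /finite_norm unlock poweR_lty//.
have /integrableP[_] := iv; apply: le_lt_trans.
rewrite le_eqVlt; apply/orP; left; apply/eqP; apply: eq_integral => x _ /=.
by rewrite normrX powR_mulrn.
Qed.

Lemma L2_measurable D v : measurable D -> L2 D v -> measurable_fun D v.
Proof.
move=> mD /L2P[mv _].
by have := (measurable_restrictT v mD).2 mv.
Qed.

Lemma L2_mul D v w : L2 D v -> L2 D w -> integ (fun x => (v \_ D) x * (w \_ D) x).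
Proof. by move=> L2v L2w; apply/Lfun1_integrable; exact: Lfun2_mul_Lfun1. Qed.

Lemma L2_bounded v c d k : measurable_fun setT (v \_ `]c, d[) ->
  (forall x, `|v x| <= k) -> L2 `]c, d[ v.
Proof.
move=> mv vk; apply/L2P; split=> //.
apply: (@le_integrable _ _ _ mu _ _ _ (EFin \o ((cst (k ^+ 2)) \_ `]c, d[))) => //.
- by apply/measurable_EFinP; exact: measurable_funX.
- move=> x _ /=; rewrite lee_fin !patchE; case: ifP => _; last by rewrite expr0n.
  by rewrite normrX (ger0_norm (sqr_ge0 _)) lerXn2r ?nnegrE// (le_trans _ (vk x)).
- exact: integ_cst_patch.
Qed.

Lemma L2_cst k c d : L2 `]c, d[ (cst k).
Proof.
apply: (L2_bounded (k := `|k|)) => //.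
by apply: integ_measurable; exact: integ_cst_patch.
Qed.

Lemma L2_continuous f c d : continuous f -> L2 `]c, d[ f.
Proof.
move=> cf; apply/L2P; split.
  apply: (measurable_restrictT _ _).1 => //.
  exact: (measurable_funS measurableT _ (continuous_measurable_fun cf)).
have -> : (fun x => (f \_ `]c, d[) x ^+ 2) = (fun x => f x ^+ 2) \_ `]c, d[.
  by apply/funext => x; rewrite !patchE; case: ifP => // _; rewrite expr0n.
apply/integ_patch => //.
apply: (@integrableS _ _ _ mu `[c, d]) => //; first exact: subset_itv_oo_cc.
apply: continuous_compact_integrable; first exact: segment_compact.
by apply: continuous_subspaceT => x; apply: (@cvgM R); exact: cf.
Qed.

Lemma L2_integ v c d : L2 `]c, d[ v -> integ (v \_ `]c, d[).
Proof.
move=> L2v; have := L2_mul L2v (L2_cst 1 c d).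
rewrite -patchM (_ : (fun x => v x * cst 1 x) = v)//.
by apply/funext => x; rewrite mulr1.
Qed.

Lemma L2D D v w : L2 D v -> L2 D w -> L2 D (fun x => v x + w x).
Proof.
rewrite /L2/= => L2v L2w.
have -> : (fun x => v x + w x) \_ D = v \_ D + w \_ D.
  by apply/funext => x; rewrite !patchE fctE !patchE; case: ifP => // _; rewrite addr0.
exact: (@Lfun_addr_closed _ _ _ mu 2%:E (lee1n 2)).2.
Qed.

Lemma L2Z D k v : L2 D v -> L2 D (fun x => k * v x).
Proof.
rewrite /L2/= => L2v.
have -> : (fun x => k * v x) \_ D = k \o* (v \_ D).
  by apply/funext => x; rewrite /= !patchE; case: ifP => // _; rewrite ?mul0r// mulrC.
by apply: Lfun_scale => //; rewrite ler1n.
Qed.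

Lemma L2B D v w : L2 D v -> L2 D w -> L2 D (fun x => v x - w x).
Proof.
move=> L2v /(L2Z (-1)) /(L2D L2v).
by congr L2; apply/funext => x; rewrite mulN1r.
Qed.

Lemma L2_patch (D E : set R) v : D `<=` E -> L2 D v -> L2 E (v \_ D).
Proof. by move=> DE; rewrite /L2/= patch_patchS. Qed.

Lemma L2S (D E : set R) v : measurable D -> D `<=` E -> L2 E v -> L2 D v.
Proof.
move=> mD DE /L2P[mv iv]; apply/L2P; rewrite -(patch_subset _ DE); split.
  have mvD : measurable_fun D (v \_ E) := measurable_funS measurableT (@subsetT _ D) mv.
  by have := (measurable_restrictT (v \_ E) mD).1 mvD.
have -> : (fun x => ((v \_ E) \_ D) x ^+ 2) = (fun x => (v \_ E) x ^+ 2) \_ D.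
  by apply/funext => x; rewrite !patchE; case: ifP => // _; rewrite expr0n.
exact: integ_patchS.
Qed.

Lemma L2_prim k g c d : integ g -> L2 `]c, d[ (fun x => k + prim g x).
Proof.
move=> ig; apply: L2D; first exact: L2_cst.
apply: (L2_bounded (k := \int[mu]_t `|g t|)); last by move=> x; exact: prim_bounded.
apply: (measurable_restrictT _ _).1 => //.
exact: (measurable_funS measurableT _ (measurable_prim ig)).
Qed.

Lemma L2innerE D v w : L2inner D v w = \int[mu]_x ((v \_ D) x * (w \_ D) x).
Proof. by rewrite /L2inner Rintegral_mkcond patchM. Qed.

Lemma L2innerC D v w : L2inner D v w = L2inner D w v.
Proof. by rewrite /L2inner; under eq_Rintegral do rewrite mulrC. Qed.

(** Measurability of [v] and [w] is a genuine assumption, as the measure is not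
    completed: it comes with [L2]. *)
Lemma L2inner_ae v w f c d : L2 `]c, d[ v -> L2 `]c, d[ w ->
  measurable_fun `]c, d[ f ->
  {ae mu, forall x, x \in `]c, d[ -> v x = w x} ->
  L2inner `]c, d[ f v = L2inner `]c, d[ f w.
Proof.
move=> L2v L2w mf vw.
have mD : measurable (`]c, d[%classic : set R) by exact: measurable_itv.
have mv := L2_measurable mD L2v; have mw := L2_measurable mD L2w.
apply: ae_eq_Rintegral => //; [exact: measurable_funM|exact: measurable_funM|].
by apply: filterS vw => x vwx xcd; rewrite vwx.
Qed.

Lemma zero_ae_L2inner c d v w : L2 `]c, d[ v -> L2 `]c, d[ w ->
  {ae mu, forall x, x \in `]c, d[ -> w x = 0} -> L2inner `]c, d[ v w = 0.
Proof.
move=> L2v L2w w0.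
rewrite (L2inner_ae L2w (L2_cst 0 c d) (L2_measurable _ L2v) w0)//.
rewrite /L2inner; under eq_Rintegral do rewrite mulr0.
by rewrite Rintegral_cst// mul0r.
Qed.

Lemma L2inner_ge0 D v : 0 <= L2inner D v v.
Proof. by apply: Rintegral_ge0 => x _; rewrite -expr2 sqr_ge0. Qed.

Lemma L2innerZr D k v w : measurable D -> L2 D v -> L2 D w ->
  L2inner D v (fun x => k * w x) = k * L2inner D v w.
Proof.
move=> mD L2v L2w; rewrite /L2inner; under eq_Rintegral do rewrite mulrCA.
by rewrite RintegralZl//; apply/integ_patch => //; rewrite patchM; exact: L2_mul.
Qed.

Lemma L2innerBr D v w w' : measurable D -> L2 D v -> L2 D w -> L2 D w' ->
  L2inner D v (fun x => w x - w' x) = L2inner D v w - L2inner D v w'.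
Proof.
move=> mD L2v L2w L2w'; rewrite /L2inner; under eq_Rintegral do rewrite mulrBr.
by rewrite RintegralB//; apply/integ_patch => //; rewrite patchM; exact: L2_mul.
Qed.

Lemma L2inner_indic l r a d v : l <= a -> d <= r ->
  L2inner `]l, r[ v ((cst (1 : R)) \_ `]a, d[) = \int[mu]_(t in `]a, d[) v t.
Proof.
move=> la dr.
have sub : `]a, d[ `<=` `]l, r[ by apply: subset_itv; rewrite bnd_simp.
rewrite L2innerE [RHS]Rintegral_mkcond; apply: eq_Rintegral => x _.
rewrite patch_patchS//; have [xin|xout] := boolP (x \in `]a, d[%classic).
  by rewrite !patchE xin (mem_set (sub _ (set_mem xin))) mulr1.
by rewrite [X in _ * X]patchE (negPf xout) mulr0 patchE (negPf xout).
Qed.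

(** The square of the norm of (w, w) v - (v, w) w is nonnegative. *)
Lemma cauchy_schwarz D v w : measurable D -> L2 D v -> L2 D w ->
  0 < L2inner D w w -> L2inner D v w ^+ 2 <= L2inner D v v * L2inner D w w.
Proof.
move=> mD L2v L2w ww0.
set B := L2inner D v w; set G := L2inner D w w; set Q := L2inner D v v.
have L2Gv := L2Z G L2v; have L2Bw := L2Z B L2w; have L2GB := L2B L2Gv L2Bw.
have := L2inner_ge0 D (fun x => G * v x - B * w x).
rewrite L2innerBr// !L2innerZr// ![L2inner D (fun x => _ - _) _]L2innerC.
rewrite !L2innerBr// !L2innerZr// [L2inner D w v]L2innerC -/B -/G -/Q.
have -> : G * (G * Q - B * B) - B * (G * B - B * G) = G * (Q * G - B ^+ 2) by ring.
by rewrite pmulr_rge0// subr_ge0.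
Qed.

Lemma L2norm_scale D b v : measurable D -> L2 D v ->
  L2norm D (b \*o v) = `|b| * L2norm D v.
Proof.
move=> mD L2v; rewrite /L2norm [L2inner D _ _](_ : _ = b ^+ 2 * L2inner D v v).
  by rewrite sqrtrM ?sqr_ge0// sqrtr_sqr.
have L2bv : L2 D (fun x => b * v x) by exact: L2Z.
by rewrite L2innerZr// L2innerC L2innerZr// mulrA expr2.
Qed.

(** x - (c + d) / 2 is then the derivative of a nonzero function that vanishes
    at both ends of ]c, d[: a test function for any boundary condition. *)
Lemma integral_centered c d : c < d ->
  \int[mu]_(x in `]c, d[) (x - (c + d) / 2) = 0.
Proof.
move=> cd; set m := (c + d) / 2.
have cf : continuous (fun x => x - m).
  by move=> x; apply: cvgB => //; exact: cvg_cst.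
pose g x := x - m; pose F x : R := 2^-1 * (g x * g x).
have dF (x : R) : is_derive x 1 F (x - m).
  have dg : is_derive x 1 g (1 - 0) by apply: is_deriveB.
  apply: (@is_derive_eq _ _ _ (2^-1 \*: (g * g)) x 1 _ _
    (is_deriveZ _ (is_deriveM dg dg))).
  by rewrite /g /GRing.scale /=; field.
have cF x : {for x, continuous F}.
  by apply: differentiable_continuous; apply/derivable1_diffP; case: (dF x).
rewrite Rintegral_itv_bndo_bndc; last first.
  by apply/integ_patch => //; exact/L2_integ/L2_continuous.
rewrite Rintegral_itv_obnd_cbnd; last first.
  apply: (@integrableS _ _ _ mu `[c, d]) => //; first exact: subset_itv_oc_cc.
  apply: continuous_compact_integrable; first exact: segment_compact.
  exact: continuous_subspaceT cf.
rewrite /Rintegral (@continuous_FTC2 _ _ F)//.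
- by rewrite -EFinB /= /F /g /m; field.
- exact: continuous_subspaceT cf.
- by split=> [x _| |]; [case: (dF x)|apply: cvg_at_right_filter; exact: cF|
    apply: cvg_at_left_filter; exact: cF].
- by move=> x _; rewrite derive1E; case: (dF x).
Qed.

End SquareIntegrable.

(** * H^1 functions of an interval are primitives *)

Section SobolevPrimitive.
Context {R : realType}.
Local Notation mu := (@lebesgue_measure R).
Local Notation integ g := (mu.-integrable setT (EFin \o g)).
Implicit Types (g v w : R -> R) (c d k l r x : R).

(** A nondegenerate interval is not negligible. *)
Lemma ae_itv_exists c d (P : R -> Prop) : c < d ->
  {ae mu, forall x, x \in `]c, d[ -> P x} -> exists2 x, x \in `]c, d[ & P x.
Proof.
move=> cd [N [mN N0 sN]]; apply: contrapT => nP.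
have : (mu `]c, d[%classic <= mu N)%E.
  apply: le_measure; rewrite ?inE//.
  apply: subset_trans sN => x xcd /= Px; apply: nP; exists x => //; exact: Px.
suff: (0%E < mu `]c, d[%classic)%E by rewrite N0 ltNge => /negP.
by rewrite lebesgue_measure_itv/= lte_fin cd -EFinB lte_fin subr_gt0.
Qed.

(** Makes boundary values meaningful: two continuous representatives of the
    same function coincide up to the boundary. *)
Lemma continuous_ae_eq v w c d : c < d ->
  {within `[c, d], continuous v} -> {within `[c, d], continuous w} ->
  {ae mu, forall x, x \in `]c, d[ -> v x = w x} ->
  forall x, x \in `[c, d] -> v x = w x.
Proof.
move=> cd cv cw vw.
have [cv1 cv2 cv3] := (continuous_within_itvP v cd).1 cv.
have [cw1 cw2 cw3] := (continuous_within_itvP w cd).1 cw.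
have inside x : x \in `]c, d[ -> v x = w x.
  move=> xcd; apply/eqP; rewrite -subr_eq0; apply/negPn/negP => h0.
  have : {for x, continuous (fun t => v t - w t)}.
    by apply: cvgB; [exact: cv1|exact: cw1].
  move=> /(@cvgr_neq0 _ R^o) /(_ h0) nz.
  have : \forall t \near x, v t - w t != 0 /\ t \in `]c, d[.
    by near=> t; split; near: t => //; exact: near_in_itvoo.
  move=> /nbhs_ballP[e /= e0 be].
  have vw' : {ae mu, forall t, t \in `]x - e, x + e[ -> t \in `]c, d[ -> v t = w t}.
    by apply: filterS vw => t + _.
  have [|t txe vwt] := ae_itv_exists _ vw'; first lra.
  have [] : v t - w t != 0 /\ t \in `]c, d[.
    by apply: be; rewrite ball_itv.
  by move=> /eqP ntw /vwt vwt'; apply: ntw; rewrite vwt' subrr.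
move=> x; rewrite in_itv/= => /andP[]; rewrite le_eqVlt => /predU1P[<- _|cx].
  apply: (@cvg_unique _ (@Rhausdorff R) (v t @[t --> c^'+])) => //.
  apply: cvg_trans cw2; apply: near_eq_cvg; near=> t.
  by apply/esym/inside; rewrite in_itv/=; apply/andP; split.
rewrite le_eqVlt => /predU1P[->|xd]; last by apply: inside; rewrite in_itv/= cx.
apply: (@cvg_unique _ (@Rhausdorff R) (v t @[t --> d^'-])) => //.
apply: cvg_trans cw3; apply: near_eq_cvg; near=> t.
by apply/esym/inside; rewrite in_itv/=; apply/andP; split.
Unshelve. all: by end_near. Qed.

(** Square integrability of [v] does not follow from that of the primitive,
    as a function equal to it almost everywhere may fail to be Borel
    measurable. *)
Definition has_primitive c d v k g : Prop :=
  [/\ L2 `]c, d[ v, L2 `]c, d[ g &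
   {ae mu, forall x, x \in `]c, d[ -> v x = k + prim (g \_ `]c, d[) x}].

Lemma prim_has_primitive k g c d : L2 `]c, d[ g ->
  has_primitive c d (fun x => k + prim (g \_ `]c, d[) x) k g.
Proof.
move=> L2g; split=> //; first exact/L2_prim/L2_integ.
exact: aeW.
Qed.

(** A test function is the primitive of its derivative, so this is
    [prim_parts] applied to [g] and to the derivative of the test function,
    whose integral vanishes. *)
Lemma prim_weak_derivative c d v k g : c < d ->
  has_primitive c d v k g -> is_weak_derivative `]c, d[ v g.
Proof.
move=> cd [L2v L2g vE]; split=> // phi tphi.
have iG := L2_integ L2g; set G := (g \_ `]c, d[) in iG vE.
have iphi : mu.-integrable `]c, d[ (EFin \o derive1 phi).
  by apply: integrableS (test_function_integrable c d tphi) => //; exact: subset_itv_oo_cc.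
have mphi : measurable_fun `]c, d[ (derive1 phi).
  by apply/measurable_EFinP; exact: measurable_int iphi.
have iPhi : integ (derive1 phi \_ `]c, d[) by apply/integ_patch.
rewrite L2innerC (L2inner_ae L2v (L2_prim k c d iG) mphi vE).
rewrite /L2inner Rintegral_mkcond.
have -> : (fun x => derive1 phi x * (k + prim G x)) \_ `]c, d[ =
    fun x => k * (derive1 phi \_ `]c, d[) x + (derive1 phi \_ `]c, d[) x * prim G x.
  apply/funext => x; rewrite !patchE; case: ifP => _; first by ring.
  by rewrite mulr0 mul0r addr0.
rewrite RintegralD//; [|exact: integZ|exact: integ_mul_prim].
rewrite RintegralZl// prim_parts//.
rewrite -Rintegral_mkcond (integral_test_function cd tphi) mulr0 mul0r !add0r.
congr (- _); rewrite [RHS]Rintegral_mkcond; apply: eq_Rintegral => x _.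
rewrite /G !patchE; case: ifPn => [|_]; last by rewrite mul0r.
by rewrite mem_setE => xcd; rewrite prim_test_function.
Qed.

(** Both [v] and the primitive of [g] have weak derivative [g], so
    du Bois-Reymond applies to their difference. *)
Lemma weak_derivative_prim c d v g : c < d -> L2 `]c, d[ v ->
  is_weak_derivative `]c, d[ v g -> exists k, has_primitive c d v k g.
Proof.
move=> cd L2v [L2g vg].
have [_ prim_g] := prim_weak_derivative cd (prim_has_primitive 0 L2g).
set p := (fun x => 0 + prim _ x) in prim_g.
have L2p : L2 `]c, d[ p by exact/L2_prim/L2_integ.
have L2vp := L2B L2v L2p.
have [|phi tphi|k vk] := @du_bois_reymond _ (fun x => v x - p x) _ _ cd.
- by apply/integ_patch => //; exact: L2_integ.
- have iphi : mu.-integrable `]c, d[ (EFin \o derive1 phi).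
    by apply: integrableS (test_function_integrable c d tphi) => //; exact: subset_itv_oo_cc.
  have L2phi : L2 `]c, d[ (derive1 phi).
    by case: tphi => _ cphi _ _; exact: L2_continuous.
  under eq_Rintegral do rewrite mulrBl.
  rewrite RintegralB//; last 2 first.
  + by apply/integ_patch => //; rewrite patchM; exact: L2_mul.
  + by apply/integ_patch => //; rewrite patchM; exact: L2_mul.
  have := vg _ tphi; have := prim_g _ tphi; rewrite /L2inner => -> ->.
  by rewrite subrr.
- exists k; split => //; apply: filterS vk => x + xcd => /(_ xcd) <-.
  by rewrite /p add0r subrK.
Qed.

(** Uniqueness of the weak derivative, and with it the meaning of [grad],
    which is only some choice of a weak derivative. *)
Lemma has_primitive_unique c d v k k' g g' : c < d ->
  has_primitive c d v k g -> has_primitive c d v k' g' ->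
  (forall x, x \in `[c, d] ->
    k + prim (g \_ `]c, d[) x = k' + prim (g' \_ `]c, d[) x) /\
  {ae mu, forall x, x \in `]c, d[ -> g x = g' x}.
Proof.
move=> cd [_ L2g vg] [_ L2g' vg'].
have iG := L2_integ L2g; have iG' := L2_integ L2g'.
have eq_cd x : x \in `[c, d] ->
    k + prim (g \_ `]c, d[) x = k' + prim (g' \_ `]c, d[) x.
  apply: (@continuous_ae_eq (fun x => k + prim (g \_ `]c, d[) x)
    (fun x => k' + prim (g' \_ `]c, d[) x) _ _ cd).
  - apply: continuous_subspaceT => y; apply: cvgD; first exact: cvg_cst.
    exact: prim_continuous.
  - apply: continuous_subspaceT => y; apply: cvgD; first exact: cvg_cst.
    exact: prim_continuous.
  - by apply: filterS2 vg vg' => y vgy vg'y ycd; rewrite -vgy// -vg'y.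
split=> //.
have iB : integ (fun x => (g \_ `]c, d[) x - (g' \_ `]c, d[) x) by exact: integB.
have BE x : x \in `[c, d] ->
  prim (fun x => (g \_ `]c, d[) x - (g' \_ `]c, d[) x) x = k' - k.
  move=> /eq_cd xcd; rewrite /prim RintegralB//; [|exact: integrableS iG|exact: integrableS iG'].
  by move: xcd; rewrite -/(prim _ x) -/(prim _ x); lra.
have cstB x y : x \in `]c, d[ -> y \in `]c, d[ ->
  prim (fun x => (g \_ `]c, d[) x - (g' \_ `]c, d[) x) x =
  prim (fun x => (g \_ `]c, d[) x - (g' \_ `]c, d[) x) y.
  by move=> xcd ycd; rewrite !BE//; exact: subset_itv_oo_cc.
apply: filterS (prim_constant_ae iB cstB) => x + xcd => /(_ xcd) /eqP.
by rewrite !patchE mem_setE xcd subr_eq0 => /eqP.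
Qed.

Lemma has_primitive_H1 c d v k g : c < d -> has_primitive c d v k g ->
  H1 `]c, d[ v.
Proof.
by move=> cd vg; split; [case: vg|exists g; exact: prim_weak_derivative vg].
Qed.

Lemma H1_has_primitive c d v : c < d -> H1 `]c, d[ v ->
  exists k, has_primitive c d v k (grad `]c, d[ v).
Proof.
move=> cd [L2v [g vg]]; apply: weak_derivative_prim => //.
exact: (@getPex _ [set g | is_weak_derivative `]c, d[ v g] (ex_intro _ g vg)).
Qed.

Lemma grad_has_primitive c d v k g : c < d -> has_primitive c d v k g ->
  {ae mu, forall x, x \in `]c, d[ -> grad `]c, d[ v x = g x}.
Proof.
move=> cd vg; have [k' vk'] := H1_has_primitive cd (has_primitive_H1 cd vg).
by have [] := has_primitive_unique cd vk' vg.
Qed.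

Lemma vanishes_on_primitive c d (A : set R) v k g : c < d -> A `<=` `[c, d] ->
  has_primitive c d v k g ->
  vanishes_on c d A v <-> forall x, A x -> k + prim (g \_ `]c, d[) x = 0.
Proof.
move=> cd Acd [_ L2g vE]; have iG := L2_integ L2g.
have cont : {within `[c, d], continuous (fun x => k + prim (g \_ `]c, d[) x)}.
  apply: continuous_subspaceT => y; apply: cvgD; first exact: cvg_cst.
  exact: prim_continuous.
split=> [[w [cw wv w0] x Ax]|A0].
  rewrite -(w0 _ Ax); apply: (continuous_ae_eq cd cont cw); last exact: Acd.
  by apply: filterS2 wv vE => y wvy vEy ycd; rewrite wvy// vEy.
exists (fun x => k + prim (g \_ `]c, d[) x); split=> //.
by apply: filterS vE => x vEx /vEx ->.
Qed.

(** Extension by zero from ]c, d[ to ]l, r[: the function k + \int g is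
    constant on either side of ]c, d[, and so is zero there if it vanishes at
    the endpoint between; a side reduced to nothing imposes no condition. *)
Lemma has_primitive_extend l r c d v k g : l <= c -> c < d -> d <= r ->
  has_primitive c d v k g ->
  k + prim (g \_ `]c, d[) c = 0 \/ c = l ->
  k + prim (g \_ `]c, d[) d = 0 \/ d = r ->
  has_primitive l r (v \_ `]c, d[) k (g \_ `]c, d[).
Proof.
move=> lc cd dr [L2v L2g vE] kc kd.
have sub : `]c, d[ `<=` `]l, r[ by apply: subset_itv; rewrite bnd_simp.
split; [exact: L2_patch|exact: L2_patch|].
rewrite patch_patchS//; apply: filterS vE => x vEx; rewrite in_itv/= => /andP[lx xr].
rewrite patchE mem_setE in_itv/=; have [cx|xc] := ltP c x; last first.
  case: kc => [|cl]; last by move: xc; rewrite cl leNgt lx.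
  by rewrite !prim_patch_left// => ->.
have [xd|dx] := ltP x d; first by rewrite vEx// in_itv/= cx xd.
case: kd => [|de]; last by move: dx; rewrite de leNgt xr.
by rewrite !prim_patch_right// => ->.
Qed.

End SobolevPrimitive.

(** * Representation of the residual *)

Section Residual.
Context {R : realType}.
Local Notation mu := (@lebesgue_measure R).
Local Notation integ g := (mu.-integrable setT (EFin \o g)).
Implicit Types (f g u v : R -> R) (b k l r x : R) (D : set R).

Lemma outflowE b l r : l < r -> b != 0 ->
  outflow b l r = [set (if b < 0 then l else r)].
Proof.
move=> lr b0; apply/seteqP; split=> x; rewrite /outflow /boundary /outward_normal /=.
  move=> [[->|->]]; first by rewrite eqxx mulrN1 oppr_gt0 => ->.
  by rewrite gt_eqF// mulr1 => /ltW; rewrite leNgt => /negPf ->.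
move=> ->; case: ltP => [bneg|bge].
  by rewrite eqxx mulrN1 oppr_gt0; split=> //; left.
by rewrite gt_eqF// mulr1 lt_neqAle eq_sym b0; split=> //; right.
Qed.

Lemma inflowE b l r : l < r -> b != 0 ->
  inflow b l r = [set (if b < 0 then r else l)].
Proof.
move=> lr b0; rewrite -[RHS](_ : outflow (- b) l r = _); last first.
  rewrite outflowE ?oppr_eq0// oppr_lt0; congr [set _].
  by case: ltgtP b0.
by apply/seteqP; split=> x; rewrite /inflow /outflow/= mulNr.
Qed.

(** The residual only sees its argument up to values outside of D; this puts
    the global norm in the form of a patch norm. *)
Lemma residual_patch_full D f u b v :
  residual D f u b (v \_ D) = residual D f u b v.
Proof.
have innerE w : L2inner D w (v \_ D) = L2inner D w v.
  by apply: eq_Rintegral => x xD; rewrite patchE xD.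
rewrite /residual innerE; congr (_ + L2inner _ _ (_ \*o _)).
rewrite /grad; congr get; apply/seteqP.
split=> g [L2g vg]; split=> // phi tphi;
  by rewrite -vg// ![L2inner _ _ (derive1 _)]L2innerC innerE.
Qed.

(** The Riesz representative q = b u - F of the residual, where F is the
    primitive of f that vanishes on the inflow boundary: at l if b > 0, at r
    if b < 0. *)
Definition flux l r b f u x : R :=
  b * u x - prim (f \_ `]l, r[) x +
  (if b < 0 then \int[mu]_(t in `]l, r[) f t else 0).

Lemma L2_flux l r b f u : L2 `]l, r[ f -> L2 `]l, r[ u -> L2 `]l, r[ (flux l r b f u).
Proof.
move=> L2f L2u; apply: L2D; last exact: L2_cst.
apply: L2B; first exact: L2Z.
have := L2_prim 0 l r (L2_integ L2f); congr L2.
by apply/funext => x; rewrite add0r.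
Qed.

Lemma residual_primitive l r b f u v k g : l < r -> b != 0 ->
  L2 `]l, r[ f -> L2 `]l, r[ u -> has_primitive l r v k g ->
  (forall x, outflow b l r x -> k + prim (g \_ `]l, r[) x = 0) ->
  residual `]l, r[ f u b v = L2inner `]l, r[ (flux l r b f u) g.
Proof.
move=> lr b0 L2f L2u vg out0; have [L2v L2g vE] := vg.
have mD : measurable (`]l, r[%classic : set R) by exact: measurable_itv.
have iF := L2_integ L2f; have iG := L2_integ L2g.
have [k' [_ L2grad _]] := H1_has_primitive lr (has_primitive_H1 lr vg).
have gradE := grad_has_primitive lr vg.
have -> : residual `]l, r[ f u b v = L2inner `]l, r[ f (fun x => k + prim (g \_ `]l, r[) x)
    + L2inner `]l, r[ u (fun x => b * g x).
  rewrite /residual; congr (_ + _).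
    apply: L2inner_ae => //; [exact: L2_prim|exact: L2_measurable].
  apply: L2inner_ae; [exact: L2Z|exact: L2Z|exact: L2_measurable|].
  by apply: filterS gradE => x xE /xE /= ->.
rewrite !L2innerE.
set F := f \_ _ in iF *; set G := g \_ _ in iG out0 *.
have -> : (fun x => F x * ((fun x => k + prim G x) \_ `]l, r[) x) =
    fun x => k * F x + F x * prim G x.
  apply/funext => x; rewrite /F !patchE; case: ifP => _; first by ring.
  by rewrite !mul0r mulr0 addr0.
have -> : (fun x => (u \_ `]l, r[) x * ((fun x => b * g x) \_ `]l, r[) x) =
    fun x => b * ((u \_ `]l, r[) x * G x).
  apply/funext => x; rewrite /G !patchE; case: ifP => _; first by ring.
  by rewrite !mul0r mulr0.
(* subtracted from prim F, c makes it vanish on the inflow boundary *)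
set c : R := if b < 0 then \int[mu]_(t in `]l, r[) f t else 0.
have -> : (fun x => (flux l r b f u \_ `]l, r[) x * G x) =
    fun x => (b * ((u \_ `]l, r[) x * G x) - G x * prim F x) + c * G x.
  apply/funext => x; rewrite /flux -/c /F /G !patchE; case: ifP => _; first by ring.
  by rewrite !(mul0r, mulr0) subr0 addr0.
have iUG := L2_mul L2u L2g.
have iGF := integ_mul_prim iG iF.
rewrite RintegralD//; [|exact: integZ|exact: integ_mul_prim].
rewrite prim_parts// [in RHS]RintegralD//; last 2 first.
- by apply: integB => //; exact: integZ.
- exact: integZ.
rewrite RintegralB//; last exact: integZ.
rewrite !RintegralZl//.
set IF := \int[mu]_x F x; set IG := \int[mu]_x G x.
(* The boundary terms: v vanishes at the outflow, which reads k + IG = 0 if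
   b > 0 and k = 0 if b < 0. *)
have key : k * IF + IF * IG = c * IG.
  have := out0 (if b < 0 then l else r); rewrite outflowE// => /(_ erefl).
  rewrite /c; case: ifP => _.
    by rewrite prim_patch_left// addr0 => ->; rewrite mul0r add0r /IF -Rintegral_mkcond.
  rewrite prim_patch_right// Rintegral_mkcond -/G -/IG mul0r => kIG.
  by rewrite mulrC -mulrDr kIG mulr0.
by rewrite -key; ring.
Qed.

End Residual.

(** * Dual norms of the residual on a subinterval *)

Section PatchSpace.
Context {R : realType}.
Local Notation mu := (@lebesgue_measure R).
Variables (l r b c d : R) (f u : R -> R) (A : set R).
Hypotheses (lr : l < r) (b0 : b != 0) (L2f : L2 `]l, r[ f) (L2u : L2 `]l, r[ u).
Hypotheses (lc : l <= c) (cd : c < d) (dr : d <= r).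
(* Test functions vanish on [A]; an endpoint may be left free only if it is also
   an endpoint of ]l, r[, and not at the outflow. *)
Hypotheses (A_boundary : A `<=` boundary c d)
  (A_c : A c \/ c = l) (A_d : A d \/ d = r)
  (A_outflow : outflow b l r `&` boundary c d `<=` A).
Implicit Types (v g : R -> R) (k x : R).

Local Notation q := (flux l r b f u).
Local Notation omega_cd := (`]c, d[%classic).

(** With [A] the outflow boundary of ]c, d[ or its whole boundary, this is
    [H1_plus] or [H1_0]; the global space is the case c = l, d = r. *)
Definition patch_space : set (R -> R) :=
  [set v | H1 omega_cd v /\ vanishes_on c d A v].

Definition patch_norm : \bar R :=
  dual_norm b omega_cd patch_space (fun v => residual `]l, r[ f u b (v \_ omega_cd)).

Let mD : measurable (`]c, d[%classic : set R). Proof. exact: measurable_itv. Qed.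

Let sub : `]c, d[ `<=` `]l, r[. Proof. by apply: subset_itv; rewrite bnd_simp. Qed.

Let L2q : L2 omega_cd q. Proof. by apply: (L2S mD sub); exact: L2_flux. Qed.

Let A_itv : A `<=` `[c, d].
Proof. by move=> x /A_boundary[] ->; rewrite /= in_itv/= lexx ?andbT ltW. Qed.

Lemma patch_spaceP v : patch_space v -> exists2 k,
  has_primitive c d v k (grad omega_cd v) &
  forall x, A x -> k + prim (grad omega_cd v \_ omega_cd) x = 0.
Proof.
move=> [H1v v0]; have [k vk] := H1_has_primitive cd H1v.
by exists k => //; apply/(vanishes_on_primitive cd A_itv vk).
Qed.

(** The extension of [v] by zero vanishes at the outflow of ]l, r[, so that
    [residual_primitive] applies to it. *)
Lemma residual_patch v k g : has_primitive c d v k g ->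
  (forall x, A x -> k + prim (g \_ omega_cd) x = 0) ->
  residual `]l, r[ f u b (v \_ omega_cd) = L2inner omega_cd q g.
Proof.
move=> vg A0.
have vgext : has_primitive l r (v \_ omega_cd) k (g \_ omega_cd).
  apply: has_primitive_extend => //.
    by case: A_c => [/A0|]; [left|right].
  by case: A_d => [/A0|]; [left|right].
rewrite (residual_primitive lr b0 L2f L2u vgext) => [|x xout].
  rewrite !L2innerE; apply: eq_Rintegral => x _.
  rewrite patch_patchS//; have [xo|xo] := boolP (x \in omega_cd).
    by rewrite !patchE (mem_set (sub (set_mem xo))) xo.
  by rewrite ![(g \_ omega_cd) x]patchE (negPf xo) !mulr0.
rewrite patch_patchS//; have [[xl|xr] _] := xout.
  have [cl|cl] := eqVneq c l.
    by apply/A0/A_outflow; split=> //; left; rewrite xl.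
  case: A_c => [/A0|cl']; last by rewrite cl' eqxx in cl.
  by rewrite !prim_patch_left// xl.
have [de|de] := eqVneq d r.
  by apply/A0/A_outflow; split=> //; right; rewrite xr.
case: A_d => [/A0|de']; last by rewrite de' eqxx in de.
by rewrite !prim_patch_right// xr.
Qed.

Lemma patch_norm_upper : (patch_norm <= (L2norm omega_cd q / `|b|)%:E)%E.
Proof.
apply/ereal_supP => _ [v [Vv _] <-]; rewrite lee_fin.
have [k vk A0] := patch_spaceP Vv; have [_ L2g _] := vk.
rewrite (residual_patch vk A0) L2norm_scale//.
have [g0|] := eqVneq (L2inner omega_cd (grad omega_cd v) (grad omega_cd v)) 0.
  rewrite [L2norm omega_cd (grad _ _)]/L2norm g0 sqrtr0 mulr0 invr0 mulr0.
  by rewrite divr_ge0 ?sqrtr_ge0.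
rewrite neq_lt ltNge L2inner_ge0/= => g0.
have n0 : 0 < L2norm omega_cd (grad omega_cd v) by rewrite sqrtr_gt0.
rewrite ler_pdivrMr ?mulr_gt0 ?normr_gt0// mulrA divfK ?normr_eq0//.
rewrite -sqrtrM ?L2inner_ge0//; apply: le_trans (ler_norm _) _.
rewrite -sqrtr_sqr ler_wsqrtr//; exact: cauchy_schwarz.
Qed.

(** The primitive of [g] is an admissible test function. *)
Lemma patch_norm_lower k g : L2 omega_cd g ->
  (forall x, A x -> k + prim (g \_ omega_cd) x = 0) -> ~ zero_ae omega_cd g ->
  ((L2inner omega_cd q g / (`|b| * L2norm omega_cd g))%:E <= patch_norm)%E.
Proof.
move=> L2g A0 gN0.
pose v x := k + prim (g \_ omega_cd) x.
have vg : has_primitive c d v k g by exact: prim_has_primitive.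
apply: ereal_sup_ubound; exists v; first split.
- split; first exact: has_primitive_H1 vg.
  exact/(vanishes_on_primitive cd A_itv vg).
- move=> v0; apply: gN0.
  have v00 : has_primitive c d v 0 (cst 0).
    have [L2v _ _] := vg; split=> //; first exact: L2_cst.
    apply: filterS v0 => x + xcd => -> //.
    rewrite (_ : cst 0 \_ _ = cst 0) ?add0r; last first.
      by apply/funext => t; rewrite patchE; case: ifP.
    by rewrite /prim; rewrite Rintegral_cst// mul0r.
  by have [_] := has_primitive_unique cd vg v00.
- congr EFin; rewrite (residual_patch vg A0); congr (_ / _).
  have [k' [_ L2grad _]] := H1_has_primitive cd (has_primitive_H1 cd vg).
  rewrite L2norm_scale//; congr (_ * Num.sqrt _).
  have gE := grad_has_primitive cd vg.
  rewrite (L2inner_ae L2grad L2g (L2_measurable mD L2grad) gE) L2innerC.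
  by rewrite (L2inner_ae L2grad L2g (L2_measurable mD L2g) gE).
Qed.

(** The supremum defining a dual norm is -oo on an empty set, so a nonzero
    element of the space has to be exhibited; one of v and - v then gives a
    nonnegative quotient. *)
Lemma patch_norm_ge0 : (0 <= patch_norm)%E.
Proof.
pose m := (c + d) / 2.
have L2m : L2 omega_cd (fun x => x - m).
  by apply: L2_continuous => x; apply: cvgB => //; exact: cvg_cst.
have bound (e : R) : e != 0 ->
  ((e * L2inner omega_cd q (fun x => x - m) /
    (`|b| * L2norm omega_cd (fun x => e * (x - m))))%:E <= patch_norm)%E.
  move=> e0; rewrite -L2innerZr//; apply: (@patch_norm_lower 0); first exact: L2Z.
    move=> x Ax; rewrite add0r; have [->|->] := A_boundary Ax.
      by rewrite prim_patch_left.
    rewrite prim_patch_right// RintegralZl//; last exact/integ_patch/L2_integ.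
    by rewrite integral_centered// mulr0.
  move=> z; have [||x] := @ae_itv_exists _ m d (fun x => e * (x - m) = 0).
  - by rewrite midf_lt.
  - apply: filterS z => x + xmd; apply; move: xmd; rewrite /= !in_itv/= => /andP[mx ->].
    by rewrite andbT (lt_trans _ mx)// midf_lt.
  - rewrite in_itv/= => /andP[mx _] /eqP.
    by rewrite mulf_eq0 (negPf e0)/= subr_eq0 gt_eqF.
have [q0|q0] := leP 0 (L2inner omega_cd q (fun x => x - m)).
  apply: le_trans (bound 1 (oner_neq0 _)).
  by rewrite lee_fin mul1r; apply: divr_ge0 => //; apply: mulr_ge0 => //; exact: sqrtr_ge0.
apply: le_trans (bound (-1) _); last by rewrite oppr_eq0 oner_eq0.
rewrite lee_fin mulN1r; apply: divr_ge0; first by rewrite oppr_ge0 ltW.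
by apply: mulr_ge0 => //; exact: sqrtr_ge0.
Qed.

(** If the primitive of q is admissible, it attains the Cauchy-Schwarz
    bound. *)
Lemma patch_normE k : (forall x, A x -> k + prim (q \_ omega_cd) x = 0) ->
  patch_norm = (L2norm omega_cd q / `|b|)%:E.
Proof.
move=> A0; apply/eqP; rewrite eq_le patch_norm_upper/=.
have [q0|q0] := eqVneq (L2inner omega_cd q q) 0.
  by rewrite /L2norm q0 sqrtr0 mul0r patch_norm_ge0.
have qpos : 0 < L2norm omega_cd q by rewrite sqrtr_gt0 lt_neqAle eq_sym q0 L2inner_ge0.
apply: le_trans (patch_norm_lower L2q A0 _); last first.
  by move=> q_ae; move/eqP: q0; apply; exact: zero_ae_L2inner.
have -> : L2inner omega_cd q q = L2norm omega_cd q ^+ 2 by rewrite sqr_sqrtr// L2inner_ge0.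
rewrite lee_fin invfM mulrA mulrAC expr2 mulfK ?gt_eqF//.
Qed.

End PatchSpace.

(** * The mesh and its hat functions *)

Section MeshVertices.
Context {R : realType}.
Variables (l r : R) (s : seq R).
Hypotheses (lr : l < r) (part_s : itv_partition l r s).
Local Notation vtx := (vertex l r s).
Local Notation n := (size s).

Lemma size_mesh_gt0 : (0 < n)%N.
Proof.
rewrite lt0n size_eq0; apply/eqP => s0; move: part_s; rewrite s0 => /itv_partition_nil lr'.
by move: lr; rewrite lr' ltxx.
Qed.

Lemma vertex_last i : (n <= i)%N -> vtx i = r.
Proof.
rewrite leq_eqVlt => /predU1P[<-|ni]; last by rewrite /vertex nth_default.
exact: itv_partition_nth_size part_s.
Qed.

Lemma vertex_ltS i : (i < n)%N -> vtx i < vtx i.+1.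
Proof. by case: part_s => /(pathP r) lt_s _; exact: lt_s. Qed.

Lemma vertex_leS i : vtx i <= vtx i.+1.
Proof.
have [/vertex_ltS/ltW//|ni] := ltnP i n.
by rewrite !vertex_last// ltnW.
Qed.

Lemma vertex_homo i j : (i <= j)%N -> vtx i <= vtx j.
Proof. by apply: (homo_leq (r := <=%R)) => //; [exact: le_trans|exact: vertex_leS]. Qed.

Lemma vertex_ge i : l <= vtx i. Proof. exact: (@vertex_homo 0). Qed.

Lemma vertex_le i : vtx i <= r.
Proof.
apply: le_trans (vertex_homo (leq_addr n i)) _.
by rewrite vertex_last// leq_addl.
Qed.

Lemma vertex_gt_l i : (0 < i)%N -> l < vtx i.
Proof.
move=> i0; apply: lt_le_trans (vertex_homo i0).
exact: (vertex_ltS size_mesh_gt0).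
Qed.

Lemma vertex_lt_r i : (i < n)%N -> vtx i < r.
Proof. by move=> /vertex_ltS vi; apply: lt_le_trans vi (vertex_le _). Qed.

Lemma omega_lt i : (i <= n)%N -> omega_l l r s i < omega_r l r s i.
Proof.
rewrite /omega_l /omega_r; case: i => [|i] ni /=; first exact: (vertex_ltS size_mesh_gt0).
exact: lt_le_trans (vertex_ltS ni) (vertex_leS _).
Qed.

Lemma interior_vertexE i : (0 < i < n)%N -> interior_vertex l r s i.
Proof.
move=> /andP[i0 ni]; rewrite /interior_vertex in_itv/= vertex_gt_l//=.
exact: vertex_lt_r.
Qed.

End MeshVertices.

Section Mesh.
Context {R : realType}.
Local Notation mu := (@lebesgue_measure R).
Variables (l r b : R) (s : seq R) (f u : R -> R).
Hypotheses (lr : l < r) (b0 : b != 0) (part_s : itv_partition l r s).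
Hypotheses (L2f : L2 `]l, r[ f) (L2u : L2 `]l, r[ u).
Local Notation vtx := (vertex l r s).
Local Notation n := (size s).
Local Notation q := (flux l r b f u).
Local Notation Omega := (`]l, r[%classic).
Local Notation P := (prim (q \_ Omega)).

Let L2q : L2 Omega q. Proof. exact: L2_flux. Qed.

Let iq : mu.-integrable setT (EFin \o (q \_ Omega)). Proof. exact: L2_integ. Qed.

(** At an extreme vertex one of the two elements is empty; its term is 0, as the
    inverse of 0 is 0 and the indicator function of an empty set is 0. *)
Definition hat_grad i x : R :=
  (vtx i - vtx i.-1)^-1 * ((cst (1 : R)) \_ `]vtx i.-1, vtx i[) x -
  (vtx i.+1 - vtx i)^-1 * ((cst (1 : R)) \_ `]vtx i, vtx i.+1[) x.

Let sub_elem i j : `]vtx i, vtx j[ `<=` Omega.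
Proof.
apply: subset_itv; rewrite bnd_simp; first exact: vertex_ge.
exact: vertex_le.
Qed.

Lemma L2_indic_elem i j : L2 Omega ((cst (1 : R)) \_ `]vtx i, vtx j[).
Proof. by apply: L2_patch; [exact: sub_elem|exact: L2_cst]. Qed.

Lemma L2_hat_grad i : L2 Omega (hat_grad i).
Proof. by apply: L2B; apply: L2Z; exact: L2_indic_elem. Qed.

Lemma prim_hat_grad i x : prim (hat_grad i \_ Omega) x =
  (vtx i - vtx i.-1)^-1 * prim ((cst (1 : R)) \_ `]vtx i.-1, vtx i[) x -
  (vtx i.+1 - vtx i)^-1 * prim ((cst (1 : R)) \_ `]vtx i, vtx i.+1[) x.
Proof.
have -> : hat_grad i \_ Omega = hat_grad i.
  apply/funext => y; rewrite patchE; case: ifPn => // yO; rewrite /hat_grad !patchE.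
  have nin j k : (y \in `]vtx j, vtx k[%classic) = false.
    by apply/negP => /set_mem/(@sub_elem j k)/mem_set; exact/negP.
  by rewrite !nin !mulr0 subrr.
have ie j k : mu.-integrable `]-oo, x] (EFin \o ((cst (1 : R)) \_ `]vtx j, vtx k[)).
  by apply: integrableS (integ_cst_patch 1 (vtx j) (vtx k)).
rewrite /prim /hat_grad RintegralB//; [|exact: integZ|exact: integZ].
by rewrite !RintegralZl.
Qed.

(** The hat function rises to 1 at its vertex, except that the one of the
    first vertex starts there. *)
Lemma hat_jump i : (i <= n)%N ->
  (i == 0%N)%:R + (vtx i - vtx i.-1)^-1 * (vtx i - vtx i.-1) = 1.
Proof.
case: i => [|i] ni; first by rewrite eqxx subrr mulr0 addr0.
by rewrite add0r mulVf// subr_eq0 gt_eqF// vertex_ltS.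
Qed.

Lemma hatE i x : (i <= n)%N -> x \in `]l, r[ ->
  hat l r s i x = (i == 0%N)%:R + prim (hat_grad i \_ Omega) x.
Proof.
move=> ni; rewrite in_itv/= => /andP[lx xr].
have v1 : vtx i.-1 <= vtx i := vertex_homo part_s (leq_pred i).
have v2 : vtx i <= vtx i.+1 := vertex_leS part_s i.
have jump := hat_jump ni.
(* x lies inside ]l, r[, so it cannot be left of the first vertex *)
have x0 : x <= vtx i -> (i == 0%N)%:R = 0 :> R.
  by case: (i) => // /(lt_le_trans lx); rewrite ltxx.
rewrite prim_hat_grad !prim_cst1// /hat.
have [xv|vx|xv] := ltgtP x (vtx i).
- rewrite x0; last exact: ltW. rewrite add0r mulr0 subr0 andbT.
  by case: ltP => _; rewrite ?mulr0// mulrC.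
- rewrite leNgt (le_lt_trans v1 vx)/= addrA jump.
  have [xv'|vx'] := ltP x (vtx i.+1).
    have h0 : vtx i.+1 - vtx i != 0 by rewrite subr_eq0 gt_eqF// (lt_trans vx).
    by field.
  rewrite mulVf ?subrr// subr_eq0 gt_eqF//.
  have [|ni'] := ltnP i n; first exact: vertex_ltS part_s _.
  by move: vx'; rewrite vertex_last// ?leNgt ?xr// (leq_trans ni').
- have i0 : (0 < i)%N.
    by rewrite lt0n; apply/eqP => i0; move: lx; rewrite xv i0 ltxx.
  have v1' : vtx i.-1 < vtx i by rewrite -{2}(prednK i0) vertex_ltS// prednK.
  by rewrite xv mulr0 subr0 leNgt v1' /= jump.
Qed.

Lemma hat_has_primitive i : (i <= n)%N ->
  has_primitive l r (hat l r s i) (i == 0%N)%:R (hat_grad i).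
Proof.
move=> ni; have L2h := L2_hat_grad i; split=> //; last by apply: nearW => x; exact: hatE.
have := L2_prim (i == 0%N)%:R l r (L2_integ L2h).
rewrite /L2/=; suff -> : hat l r s i \_ Omega =
  (fun x => (i == 0%N)%:R + prim (hat_grad i \_ Omega) x) \_ Omega by [].
apply/funext => x; rewrite !patchE.
by case: ifPn => //; rewrite mem_setE => xO; rewrite hatE.
Qed.

(** With [P] the primitive of q, the two terms are the means of q on the
    elements left and right of vertex i. *)
Lemma residual_hat i : (i <= n)%N ->
  interior_vertex l r s i \/ inflow_vertex b l r s i ->
  residual Omega f u b (hat l r s i) =
  (vtx i - vtx i.-1)^-1 * (P (vtx i) - P (vtx i.-1)) -
  (vtx i.+1 - vtx i)^-1 * (P (vtx i.+1) - P (vtx i)).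
Proof.
move=> ni inti.
have v1 : vtx i.-1 <= vtx i := vertex_homo part_s (leq_pred i).
have v2 : vtx i <= vtx i.+1 := vertex_leS part_s i.
rewrite (residual_primitive lr b0 L2f L2u (hat_has_primitive ni)); last first.
  rewrite outflowE// => _ ->.
  have : if b < 0 then (0 < i)%N else (i < n)%N.
    case: inti; rewrite /interior_vertex /inflow_vertex.
      rewrite in_itv/= => /andP[lv vr]; case: ifP => _.
        by rewrite lt0n; apply/eqP => i0; move: lv; rewrite i0 ltxx.
      by rewrite ltnNge; apply/negP => /(vertex_last part_s) vE; move: vr; rewrite vE ltxx.
    rewrite inE inflowE//=; case: ifP => _ vE.
      by rewrite lt0n; apply/eqP => i0; move: lr; rewrite -vE i0 ltxx.
    rewrite ltnNge; apply/negP => /(vertex_last part_s) vE'.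
    by move: lr; rewrite -vE' vE ltxx.
  have vl := vertex_ge part_s; have vr := vertex_le part_s.
  case: ifP => _ ii.
    by rewrite prim_patch_left// addr0 eqn0Ngt ii.
  have prim_r a d : a <= d -> d <= r -> prim ((cst (1 : R)) \_ `]a, d[) r = d - a.
    by move=> ad dr; rewrite prim_patch_right// integral_cst_itv// mul1r.
  rewrite prim_hat_grad !prim_r// addrA hat_jump// mulVf ?subrr//.
  by rewrite subr_eq0 gt_eqF// vertex_ltS.
have mO : measurable (`]l, r[%classic : set R) by exact: measurable_itv.
rewrite L2innerBr//; [|exact/L2Z/L2_indic_elem|exact/L2Z/L2_indic_elem].
rewrite !L2innerZr//; [|exact: L2_indic_elem|exact: L2_indic_elem].
have vl := vertex_ge part_s; have vr := vertex_le part_s.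
by rewrite !L2inner_indic// !(integral_primB _ _ _ iq).
Qed.

End Mesh.

(** * Global and local norms *)

(** The shape of a sum over patches, each reaching from the preceding vertex
    to the following one; a patch with a missing neighbour is covered by
    0.-1 = 0. *)
Lemma sum_telescope2 (R : realType) (a : nat -> R) n :
  \sum_(i < n.+1) (a i.+1 - a i.-1) = a n.+1 + a n - 2 * a 0%N.
Proof.
elim: n => [|n IHn]; first by rewrite big_ord1/=; ring.
by rewrite big_ord_recr/= IHn; ring.
Qed.

Section Norms.
Context {R : realType}.
Local Notation mu := (@lebesgue_measure R).
Variables (l r b : R) (s : seq R) (f u : R -> R).
Hypotheses (lr : l < r) (b0 : b != 0) (part_s : itv_partition l r s).
Hypotheses (L2f : L2 `]l, r[ f) (L2u : L2 `]l, r[ u).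
Local Notation vtx := (vertex l r s).
Local Notation n := (size s).
Local Notation q := (flux l r b f u).
Local Notation Omega := (`]l, r[%classic).
Local Notation P := (prim (q \_ Omega)).

Let L2q : L2 Omega q. Proof. exact: L2_flux. Qed.
Let iq : mu.-integrable setT (EFin \o (q \_ Omega)). Proof. exact: L2_integ. Qed.

Lemma global_residual_normE :
  global_residual_norm b l r f u = (L2norm Omega q / `|b|)%:E.
Proof.
have <- : patch_norm l r b l r f u (outflow b l r) = global_residual_norm b l r f u.
  have TE : (fun v => residual Omega f u b (v \_ Omega)) = residual Omega f u b.
    by apply/funext => v; rewrite residual_patch_full.
  by rewrite /patch_norm TE.
have A_sub : outflow b l r `<=` boundary l r by move=> x [].
have A_l : outflow b l r l \/ l = l by right.
have A_r : outflow b l r r \/ r = r by right.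
have A_out : outflow b l r `&` boundary l r `<=` outflow b l r by move=> x [].
(* the value at l of the primitive of q that vanishes at the outflow *)
pose k := if b < 0 then 0 else - \int[mu]_(t in Omega) q t.
apply: (patch_normE lr b0 L2f L2u (lexx l) lr (lexx r) A_sub A_l A_r A_out (k := k)).
rewrite /k outflowE// => _ ->; case: ifP => _.
  by rewrite prim_patch_left// addr0.
by rewrite prim_patch_right// addNr.
Qed.

(** Where the functions of [H1_sharp] vanish. *)
Definition sharp_boundary i : set R :=
  if vtx i \in inflow b l r then outflow b (omega_l l r s i) (omega_r l r s i)
  else boundary (omega_l l r s i) (omega_r l r s i).

Lemma local_residual_normE i : local_residual_norm b l r s f u i =
  patch_norm l r b (omega_l l r s i) (omega_r l r s i) f u (sharp_boundary i).
Proof.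
rewrite /local_residual_norm /patch_norm.
suff -> : H1_sharp b l r s i =
  patch_space (omega_l l r s i) (omega_r l r s i) (sharp_boundary i) by [].
by rewrite /H1_sharp /patch_space /sharp_boundary; case: ifP.
Qed.

Section LocalNorm.
Variable i : nat.
Hypothesis ni : (i <= n)%N.
Local Notation c := (omega_l l r s i).
Local Notation d := (omega_r l r s i).

Let lc : l <= c. Proof. exact: vertex_ge. Qed.
Let dr : d <= r. Proof. exact: vertex_le. Qed.
Let cd : c < d. Proof. exact: omega_lt. Qed.

Lemma sharp_boundary_sub : sharp_boundary i `<=` boundary c d.
Proof. by rewrite /sharp_boundary; case: ifP => _ x; [case|]. Qed.
Lemma inflow_index : vtx i \in inflow b l r -> i = if b < 0 then n else 0%N.
Proof.
rewrite inE inflowE//=; case: ifP => _ vE.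
  apply/eqP; rewrite eqn_leq ni /= leqNgt; apply/negP => /(vertex_lt_r part_s).
  by rewrite vE ltxx.
by apply/eqP; rewrite -leqn0 leqNgt; apply/negP => /(vertex_gt_l lr part_s); rewrite vE ltxx.
Qed.

(** Functions of a patch space are only left free at an inflow vertex of
    ]l, r[, across which no extension is needed. *)
Lemma sharp_boundary_l : sharp_boundary i c \/ c = l.
Proof.
rewrite /sharp_boundary; case: ifPn => [/inflow_index iE|_]; last by left; left.
rewrite outflowE//; case: ifP iE => _ iE; first by left.
by right; rewrite /omega_l iE.
Qed.

Lemma sharp_boundary_r : sharp_boundary i d \/ d = r.
Proof.
rewrite /sharp_boundary; case: ifPn => [/inflow_index iE|_]; last by left; right.
rewrite outflowE//; case: ifP iE => _ iE; last by left.
by right; rewrite /omega_r iE vertex_last.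
Qed.

Lemma sharp_boundary_outflow : outflow b l r `&` boundary c d `<=` sharp_boundary i.
Proof.
rewrite /sharp_boundary; case: ifPn => _ x [xout xcd] //.
move: xout; rewrite !outflowE//; case: ifP => _ /= xE.
  by case: xcd => xE' //; move: cd; rewrite -xE' xE ltNge lc.
by case: xcd => xE' //; move: cd; rewrite -xE' xE ltNge dr.
Qed.

Lemma local_norm_ge0 : (0 <= local_residual_norm b l r s f u i)%E.
Proof.
rewrite local_residual_normE.
exact: (patch_norm_ge0 lr b0 L2f L2u lc cd dr sharp_boundary_sub
  sharp_boundary_l sharp_boundary_r sharp_boundary_outflow).
Qed.

Lemma local_norm_upper : (local_residual_norm b l r s f u i <=
  (L2norm (omega l r s i) q / `|b|)%:E)%E.
Proof.
rewrite local_residual_normE.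
exact: (patch_norm_upper lr b0 L2f L2u lc cd dr sharp_boundary_sub
  sharp_boundary_l sharp_boundary_r sharp_boundary_outflow).
Qed.

Lemma local_normE : P c = P d -> local_residual_norm b l r s f u i =
  (L2norm (omega l r s i) q / `|b|)%:E.
Proof.
move=> Pcd; rewrite local_residual_normE.
apply: (patch_normE lr b0 L2f L2u lc cd dr sharp_boundary_sub
  sharp_boundary_l sharp_boundary_r sharp_boundary_outflow (k := 0)).
move=> x /sharp_boundary_sub[] ->; rewrite add0r.
  by rewrite prim_patch_left.
by rewrite prim_patch_right// (integral_primB lc (ltW cd) dr iq) Pcd subrr.
Qed.

End LocalNorm.

(** Every element of the mesh belongs to the patches of its two ends. *)
Lemma sum_L2_omega :
  \sum_(i < n.+1) L2inner (omega l r s i) q q = 2 * L2inner Omega q q.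
Proof.
have iqq : mu.-integrable setT (EFin \o ((fun x => q x * q x) \_ Omega)).
  by rewrite patchM; exact: L2_mul.
pose Q := prim ((fun x => q x * q x) \_ Omega).
have -> : \sum_(i < n.+1) L2inner (omega l r s i) q q =
    \sum_(i < n.+1) (Q (vtx i.+1) - Q (vtx i.-1)).
  apply: eq_bigr => i _; apply: integral_primB => //.
  - exact: vertex_ge.
  - by apply/ltW/omega_lt => //; rewrite -ltnS.
  - exact: vertex_le.
rewrite (sum_telescope2 (fun i => Q (vtx i))) [vtx n.+1]vertex_last// [vtx n]vertex_last//.
rewrite /L2inner (integral_primB (lexx l) (ltW lr) (lexx r) iqq) -/Q.
rewrite (_ : vertex l r s 0 = l)//; ring.
Qed.

(** Orthogonality to the interior hat functions makes the element means m i of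
    q all equal; the inflow hat function, at the first or the last vertex
    according to the sign of b, makes the mean of the adjacent element 0. *)
Lemma orthogonality_mean0 :
  (forall i : 'I_n.+1, interior_vertex l r s i \/ inflow_vertex b l r s i ->
     residual Omega f u b (hat l r s i) = 0) ->
  forall i, P (vtx i) = 0.
Proof.
move=> orth.
pose m i := (vtx i.+1 - vtx i)^-1 * (P (vtx i.+1) - P (vtx i)).
have orth' i : (i <= n)%N -> interior_vertex l r s i \/ inflow_vertex b l r s i ->
    (vtx i - vtx i.-1)^-1 * (P (vtx i) - P (vtx i.-1)) = m i.
  move=> ni inti; apply/eqP; rewrite -subr_eq0 -(residual_hat lr b0 part_s L2f L2u ni inti).
  by rewrite -ltnS in ni; rewrite (orth (Ordinal ni)).
have mS i : (i.+1 < n)%N -> m i = m i.+1.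
  by move=> ni; apply: orth' (ltnW ni) _; left; exact: interior_vertexE.
have n0 := size_mesh_gt0 lr part_s.
have m_cst i : (i < n)%N -> m i = m 0%N.
  by elim: i => // i IHi ni; rewrite -mS// IHi// ltnW.
have m00 : m 0%N = 0.
  have [bneg|bge] := ltP b 0.
    rewrite -(m_cst n.-1) ?prednK//.
    have := orth' n (leqnn _); rewrite /m prednK// => ->.
      by rewrite !vertex_last// !subrr mulr0.
    by right; rewrite /inflow_vertex inE inflowE//= bneg vertex_last.
  rewrite -orth'// ?subrr ?mulr0//.
  by right; rewrite /inflow_vertex inE inflowE//= ltNge bge.
elim=> [|i IHi]; first by rewrite prim_patch_left.
have [ni|ni] := ltnP i n; last by rewrite -IHi !vertex_last// ltnW.
have := m_cst i ni; rewrite m00 /m IHi subr0 => /eqP.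
by rewrite mulf_eq0 invr_eq0 subr_eq0 gt_eqF ?vertex_ltS//= => /eqP.
Qed.

(** The maximum ranges over a nonempty set, and each of its terms is 1 plus a
    nonnegative number. *)
Lemma C_cont_ge1 (C_PF : 'I_n.+1 -> R) :
  (forall i : 'I_n.+1, poincare_constant b l r s i (C_PF i)) -> (1 <= C_cont_PF l r C_PF)%E.
Proof.
move=> PF; rewrite /C_cont_PF (bigD1 ord0)//= le_max; apply/orP; left.
rewrite leeDl// mule_ge0 ?mule_ge0 ?lee_fin//; last exact: Lnorm_ge0.
- by have [/ltW] := PF ord0.
- by rewrite subr_ge0; apply/ltW/omega_lt.
Qed.

Lemma sqr_norm_flux (D : set R) :
  ((L2norm D q / `|b|)%:E ^+ 2 = (L2inner D q q / b ^+ 2)%:E)%E.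
Proof.
rewrite expe2 -EFinM; congr EFin.
by rewrite mulrACA -expr2 sqr_sqrtr ?L2inner_ge0// -invfM -normrM -expr2 ger0_norm ?sqr_ge0.
Qed.

End Norms.

Theorem theorem4p3 (R : realType) (l r b kappa : R) (s : seq R)
    (f u : R -> R) (l_lt_r : l < r) (b_neq0 : b != 0)
    (mesh_s : mesh l r s kappa)
    (L2f : L2 `]l, r[ f) (L2u : L2 `]l, r[ u) :
  (forall C_PF : 'I_(size s).+1 -> R,
     (forall i : 'I_(size s).+1, poincare_constant b l r s i (C_PF i)) ->
     (forall i : 'I_(size s).+1,
        interior_vertex l r s i \/ inflow_vertex b l r s i ->
        residual `]l, r[ f u b (hat l r s i) = 0) ->
     (global_residual_norm b l r f u ^+ 2
      <= 2%:E * C_cont_PF l r C_PF ^+ 2 *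
         \sum_(i < (size s).+1) local_residual_norm b l r s f u i ^+ 2)%E)
  /\
  (\sum_(i < (size s).+1) local_residual_norm b l r s f u i ^+ 2
   <= 2%:E * global_residual_norm b l r f u ^+ 2)%E.
Proof.
have part_s : itv_partition l r s by case: mesh_s.
have sum2 : (\sum_(i < (size s).+1)
    (L2norm (omega l r s i) (flux l r b f u) / `|b|)%:E ^+ 2 =
  2%:E * global_residual_norm b l r f u ^+ 2)%E.
  rewrite global_residual_normE// sqr_norm_flux -EFinM mulrA.
  rewrite -(sum_L2_omega b l_lt_r part_s L2f L2u).
  rewrite mulr_suml -sumEFin; apply: eq_bigr => i _; exact: sqr_norm_flux.
split=> [C_PF PF orth|]; last first.
  rewrite -sum2; apply: lee_sum => i _; rewrite !expe2.
  have ni : (i <= size s)%N by rewrite -ltnS.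
  by apply: lee_pmul; rewrite ?local_norm_ge0 ?local_norm_upper.
have P0 := orthogonality_mean0 l_lt_r b_neq0 part_s L2f L2u orth.
rewrite [X in (_ <= _ * X)%E](_ : _ =
  2%:E * global_residual_norm b l r f u ^+ 2)%E; last first.
  rewrite -sum2; apply: eq_bigr => i _; rewrite local_normE//; first by rewrite -ltnS.
  by rewrite !P0.
have C1 := C_cont_ge1 l_lt_r part_s PF.
set G := (global_residual_norm b l r f u ^+ 2)%E.
have G0 : (0 <= G)%E.
  rewrite /G global_residual_normE// sqr_norm_flux lee_fin.
  by rewrite divr_ge0 ?L2inner_ge0 ?sqr_ge0.
have C2 : (1 <= C_cont_PF l r C_PF ^+ 2)%E.
  by rewrite expe2 -[leLHS]mule1; apply: lee_pmul.
have le_double (x : \bar R) : (0 <= x -> x <= 2%:E * x)%E.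
  by move=> x0; rewrite -[leLHS]mul1e lee_wpmul2r// lee_fin ler1n.
apply: (le_trans (le_double _ G0)).
rewrite -[leLHS]mul1e lee_wpmul2r//; first by rewrite mule_ge0.
by apply: (le_trans C2); apply: le_double; exact: le_trans C2.
Qed.
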